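(* Let $1\le k\le n$. For a real symmetric $(n+1)\times(n+1)$ matrix $R=(r_{ij})_{0\le i,j\le n}$, write $r=(r_{ij})_{1\le i,j\le n}$, $x=(r_{01},\dots,r_{0n})$, and $$F_k(R)=r_{00}\,\sigma_k(r)-x\,T_{k-1}(r)\,x^T.$$ Let $\mathcal S=\{R: r\in\Gamma_k^+,\ F_k(R)>0\}$. Then $\mathcal S$ is a convex cone and $F_k^{1/(k+1)}$ is concave on $\mathcal S$; consequently $\log F_k$ is also concave on $\mathcal S$.
   Context: For a real symmetric $n\times n$ matrix $r$, $\sigma_j(r)$ is the $j$-th elementary symmetric function of its eigenvalues ($\sigma_0=1$), $\Gamma_k^+=\{r:\sigma_j(r)>0,\ 1\le j\le k\}$, and the Newton transformation is $T_{j}(r)=\sum_{i=0}^{j}(-1)^i\sigma_{j-i}(r)r^i$. *)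

(* Defs.v *)
From Stdlib Require Import Reals Lra ClassicalEpsilon FunctionalExtensionality
  PropExtensionality.
From HB Require Import structures.
From mathcomp Require Import all_boot all_order all_algebra.
Set Implicit Arguments. Unset Strict Implicit. Unset Printing Implicit Defensive.

Definition R_eqb (x y : R) : bool := if Req_EM_T x y then true else false.
Lemma R_eqP : Equality.axiom R_eqb.
Proof. move=> x y; rewrite /R_eqb; case: Req_EM_T => h; by constructor. Qed.
HB.instance Definition _ := hasDecEq.Build R R_eqP.

Definition R_find (P : pred R) (n : nat) : option R :=
  match excluded_middle_informative (exists x, P x) with
  | left h => Some (proj1_sig (constructive_indefinite_description _ h))
  | right _ => None
  end.
Lemma R_find_correct P n x : R_find P n = Some x -> P x.
Proof.
rewrite /R_find; case: excluded_middle_informative => // h [<-].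
exact: proj2_sig (constructive_indefinite_description _ h).
Qed.
Lemma R_find_complete (P : pred R) : (exists x, P x) -> exists n, R_find P n.
Proof. move=> h; exists 0%N; rewrite /R_find; by case: excluded_middle_informative. Qed.
Lemma R_find_ext (P Q : pred R) : P =1 Q -> R_find P =1 R_find Q.
Proof. move=> h; have -> : P = Q by apply: functional_extensionality. by []. Qed.
HB.instance Definition _ :=
  hasChoice.Build R R_find_correct R_find_complete R_find_ext.

Lemma R_addA : ssrfun.associative Rplus. Proof. move=> *; lra. Qed.
Lemma R_addC : ssrfun.commutative Rplus. Proof. move=> *; lra. Qed.
Lemma R_add0 : ssrfun.left_id R0 Rplus. Proof. move=> *; lra. Qed.
Lemma R_addN : ssrfun.left_inverse R0 Ropp Rplus. Proof. move=> *; lra. Qed.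
HB.instance Definition _ := GRing.isZmodule.Build R R_addA R_addC R_add0 R_addN.

Lemma R_mulA : ssrfun.associative Rmult. Proof. move=> *; ring. Qed.
Lemma R_mulC : ssrfun.commutative Rmult. Proof. move=> *; ring. Qed.
Lemma R_mul1 : ssrfun.left_id R1 Rmult. Proof. move=> *; ring. Qed.
Lemma R_mulDl : ssrfun.left_distributive Rmult Rplus. Proof. move=> *; ring. Qed.
Lemma R_one_neq0 : R1 != R0.
Proof. apply/eqP; exact: R1_neq_R0. Qed.
HB.instance Definition _ :=
  GRing.Zmodule_isComNzRing.Build R R_mulA R_mulC R_mul1 R_mulDl R_one_neq0.

Local Open Scope ring_scope.

(* sigma_j(r) = j-th elementary symmetric function of the eigenvalues of r,
   read off the characteristic polynomial:
   char_poly r = det(X I - r) = \prod_i (X - lambda_i)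
               = \sum_j (-1)^j sigma_j(r) X^(n-j).
   sigma_0 = 1 (char_poly is monic); sigma_j = 0 for j > n. *)
Definition sigma (n : nat) (j : nat) (r : 'M[R]_n) : R :=
  if (j <= n)%N then (-1) ^+ j * (char_poly r)`_(n - j) else 0.

Definition in_Gamma_plus (n k : nat) (r : 'M[R]_n) : Prop :=
  forall j : nat, (1 <= j)%N -> (j <= k)%N -> Rlt R0 (sigma j r).

Definition newton_T (n : nat) (j : nat) (r : 'M[R]_n) : 'M[R]_n :=
  \sum_(i < j.+1) (((-1) ^+ i * sigma (j - i) r) *: (r ^+ i)).

Definition symmetricmx (m : nat) (A : 'M[R]_m) : Prop := A^T = A.

Definition blk_r (n : nat) (M : 'M[R]_n.+1) : 'M[R]_n :=
  \matrix_(i < n, j < n) M (lift ord0 i) (lift ord0 j).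
Definition blk_x (n : nat) (M : 'M[R]_n.+1) : 'rV[R]_n :=
  \row_(j < n) M ord0 (lift ord0 j).

Definition Fk (n k : nat) (M : 'M[R]_n.+1) : R :=
  M ord0 ord0 * sigma k (blk_r M)
  - (blk_x M *m newton_T k.-1 (blk_r M) *m (blk_x M)^T) ord0 ord0.

Definition in_S (n k : nat) (M : 'M[R]_n.+1) : Prop :=
  symmetricmx M /\ in_Gamma_plus k (blk_r M) /\ Rlt R0 (Fk k M).

(* Main.v *)
(* F_k(R) is, up to sign, the coefficient of T^(n-k) in det(T P - R) with
   P = diag(0,1,...,1), i.e. a derivative of det in a positive semidefinite
   direction. Gauss-Lucas in a half-plane shows that F_k is hyperbolic in the
   direction I. As in Garding's theory, hyperbolicity is propagated from I to
   every element of S: along a segment on which F_k does not vanish, the roots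
   of z |-> F_k(X + i a A + z B) cannot cross the real line. S is connected to I
   by two such segments, first to diag(c, r) with c large and then to R. Hence
   for A, B in S one has F_k(A + t B) = F_k(B) prod (t + mu_j) with all mu_j > 0,
   and concavity is the inequality between geometric and arithmetic means. *)

Require Import Defs.
From Stdlib Require Import Reals Lra FunctionalExtensionality.
From HB Require Import structures.
From mathcomp Require Import all_boot all_order all_algebra.
From mathcomp Require Import complex ring lra zify.
Set Implicit Arguments. Unset Strict Implicit. Unset Printing Implicit Defensive.
Import Order.TTheory GRing.Theory Num.Theory.
Local Open Scope ring_scope.

(* The Stdlib [Reals] library exports another constant called [sigma]. *)
Local Notation sigma := Defs.sigma.

(** * The Stdlib reals as a real closed field *)

(** The shift by i a A, a > 0, is what makes the propagation work. Hyperbolicity of A alone keeps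
    F_k(X + i a A + x B) nonzero for every real x and every symmetric B, so along a segment of
    directions B a root z could only be lost at infinity; this is excluded by F_k(B) <> 0, the
    coefficient of z^(k+1). Letting a tend to 0 then gives the hyperbolicity of B. Openness and
    closedness in the parameter both rest on explicit lower bounds for polynomials without roots in
    the closed upper half-plane. A pair A, B needs two runs: one from I to A, and, after exchanging
    the roles of I and A, one with base A that starts at I and ends at B. *)

Lemma R_mulVf (x : R) : x != 0 -> Rinv x * x = 1.
Proof. by move/eqP => h; exact: Rinv_l. Qed.

HB.instance Definition _ := GRing.ComNzRing_isField.Build R R_mulVf Rinv_0.

Definition R_leb (x y : R) : bool := if Rle_dec x y then true else false.
Definition R_ltb (x y : R) : bool := if Rlt_dec x y then true else false.

Lemma R_lebP x y : reflect (Rle x y) (R_leb x y).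
Proof. by rewrite /R_leb; case: Rle_dec => h; constructor. Qed.

Lemma R_ltbP x y : reflect (Rlt x y) (R_ltb x y).
Proof. by rewrite /R_ltb; case: Rlt_dec => h; constructor. Qed.

Lemma R_le0_add x y : R_leb 0 x -> R_leb 0 y -> R_leb 0 (x + y).
Proof. by move=> /R_lebP hx /R_lebP hy; apply/R_lebP; exact: Rplus_le_le_0_compat. Qed.

Lemma R_le0_mul x y : R_leb 0 x -> R_leb 0 y -> R_leb 0 (x * y).
Proof. by move=> /R_lebP hx /R_lebP hy; apply/R_lebP; exact: Rmult_le_pos. Qed.

Lemma R_le0_anti x : R_leb 0 x -> R_leb x 0 -> x = 0.
Proof. by move=> /R_lebP hx /R_lebP hy; exact: Rle_antisym. Qed.

Lemma R_sub_ge0 x y : R_leb 0 (y - x) = R_leb x y.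
Proof.
apply/R_lebP/R_lebP; rewrite /GRing.add /GRing.opp /GRing.zero /= => h; Lra.lra.
Qed.

Lemma R_le0_total x : R_leb 0 x || R_leb x 0.
Proof.
by case: (Rle_dec 0 x) => h; apply/orP; [left | right]; apply/R_lebP => //;
  apply: Rlt_le; apply: Rnot_le_lt.
Qed.

Lemma R_ge0_norm x : R_leb 0 x -> Rabs x = x.
Proof. by move/R_lebP => h; apply: Rabs_pos_eq. Qed.

Lemma R_lt_def x y : R_ltb x y = (y != x) && R_leb x y.
Proof.
apply/R_ltbP/andP => [h | [/eqP h1 /R_lebP h2]]; last by Lra.lra.
by split; [apply/eqP; Lra.lra | apply/R_lebP; Lra.lra].
Qed.

HB.instance Definition _ := Num.IntegralDomain_isLeReal.Build R
  R_le0_add R_le0_mul R_le0_anti R_sub_ge0 R_le0_total Rabs_Ropp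
  R_ge0_norm R_lt_def.

Lemma RleP (x y : R) : reflect (Rle x y) (x <= y). Proof. exact: R_lebP. Qed.
Lemma RltP (x y : R) : reflect (Rlt x y) (x < y). Proof. exact: R_ltbP. Qed.

Lemma continuity_horner (p : {poly R}) : continuity (horner p).
Proof.
elim/poly_ind: p => [|p c ih].
  by have -> : horner 0 = fct_cte 0;
    [apply: functional_extensionality => x; rewrite horner0 | exact: continuity_const].
have -> : horner (p * 'X + c%:P) = plus_fct (mult_fct (horner p) id) (fct_cte c).
  by apply: functional_extensionality => x; rewrite hornerMXaddC.
apply: continuity_plus; last by exact: continuity_const.
by apply: continuity_mult => // x; exact: derivable_continuous_pt (derivable_pt_id x).
Qed.

(** The last axiom of a real closed field; it makes [R[i]] algebraically closed, so that polynomials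
    split there. *)
Lemma R_poly_ivt : Num.real_closed_axiom R.
Proof.
move=> p a b hab /andP[ha hb].
have [||x [[h1 h2] h3]] := IVT_cor (horner p) a b (continuity_horner p).
- exact/RleP.
- by apply/RleP; exact: (mulr_le0_ge0 ha hb).
by exists x; [apply/andP; split; apply/RleP | apply/eqP].
Qed.

HB.instance Definition _ := Num.RealField_isClosed.Build R R_poly_ivt.

(** * Polynomials with roots in the lower half-plane *)

Section HalfPlane.
Variable C : numClosedFieldType.
Implicit Types (f : {poly C}) (z r s : C).

Definition lower_rooted f := forall z, 0 <= 'Im z -> f.[z] != 0.

Lemma Im_inv_lt0 z : 0 < 'Im z -> 'Im z^-1 < 0.
Proof.
move=> hz; have z0 : z != 0 by apply: contraTneq hz => ->; rewrite raddf0 ltxx.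
by rewrite ImV mulNr oppr_lt0 divr_gt0 // exprn_gt0 // normr_gt0.
Qed.

Lemma lower_rooted_factor f : lower_rooted f ->
  {rs : seq C | f = lead_coef f *: \prod_(r <- rs) ('X - r%:P) &
                all (fun r => 'Im r < 0) rs}.
Proof.
move=> hf; have [rs hrs] := closed_field_poly_normal f; exists rs => //.
apply/allP => r hr; rewrite real_ltNge ?real0 ?Creal_Im //.
apply/negP => /hf; rewrite hrs hornerZ horner_prod.
by rewrite (big_rem r) //= hornerXsubC subrr mul0r mulr0 eqxx.
Qed.

(* The logarithmic derivative is a sum of terms 1 / (z - r), each with negative imaginary part. *)
Lemma log_deriv_prod (rs : seq C) z : all (fun r => 'Im r < 0) rs -> 0 <= 'Im z ->
  let f := \prod_(r <- rs) ('X - r%:P) in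
  f.[z] != 0 /\ (rs <> [::] -> 'Im (f^`().[z] / f.[z]) < 0).
Proof.
move=> + hz; elim: rs => [_ | r rs ih /= /andP[hr hrs]] /=.
  by rewrite big_nil hornerC oner_neq0; split.
have [h1 h2] := ih hrs.
have hzr : 0 < 'Im (z - r) by rewrite raddfB /= subr_gt0 (lt_le_trans hr).
have zr0 : z - r != 0 by apply: contraTneq hzr => ->; rewrite raddf0 ltxx.
rewrite big_cons derivM derivXsubC mul1r hornerD !hornerM hornerXsubC; split.
  by rewrite mulf_neq0.
move=> _; set f := \prod_(_ <- _) _ in h1 h2 *.
have -> : (f.[z] + (z - r) * f^`().[z]) / ((z - r) * f.[z])
   = (z - r)^-1 + f^`().[z] / f.[z].
  by field; rewrite h1 zr0.
rewrite raddfD /= -[X in _ < X]addr0 ltr_leD //; first exact: Im_inv_lt0.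
case: rs @f ih hrs h1 h2 => [|a l] f ih hrs h1 h2; last by apply: ltW; apply: h2.
by rewrite /f big_nil derivC horner0 mul0r raddf0.
Qed.

Lemma gauss_lucas f : lower_rooted f -> f^`() != 0 -> lower_rooted f^`().
Proof.
move=> hf hf' z hz; have [rs ef hrs] := lower_rooted_factor hf.
have [h1 h2] := log_deriv_prod hrs hz.
have c0 : lead_coef f != 0.
  by apply: contraNneq hf' => c0; rewrite ef c0 scale0r deriv0.
move: hf'; rewrite ef derivZ hornerZ => hf'; rewrite mulf_neq0 //.
have /h2 : rs <> [::] by move=> e; move: hf'; rewrite e big_nil derivC scaler0 eqxx.
by apply: contraTneq => ->; rewrite mul0r raddf0 ltxx.
Qed.

(** The coefficient is the j-th derivative at 0 divided by j!, and by Gauss-Lucas 0, a point of the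
    closed upper half-plane, is no root of that derivative. *)
Lemma lower_rooted_coef f j : lower_rooted f -> (j < size f)%N -> f`_j != 0.
Proof.
move=> hf hj.
have key i : (i <= j)%N -> lower_rooted f^`(i).
  elim: i => [_|i ih hi]; first by rewrite derivn0.
  rewrite derivnS; apply: gauss_lucas; first by apply: ih; exact: ltnW.
  (* The next derivative is not zero: in characteristic 0 its top coefficient is a nonzero multiple
     of [lead_coef f]. *)
  rewrite -derivnS; apply/eqP => /polyP /(_ ((size f).-1 - i.+1)%N).
  have hs : (i.+1 <= (size f).-1)%N by apply: leq_trans hi _;
    rewrite -ltnS prednK // (leq_ltn_trans _ hj).
  rewrite coef_derivn coef0 subnKC // => /eqP; rewrite mulrn_eq0 -lead_coefE lead_coef_eq0.
  rewrite eqn0Ngt ffact_gt0 hs /= => /eqP f0; by rewrite f0 size_poly0 in hj.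
have := key j (leqnn j) 0; rewrite raddf0 lexx => /(_ isT).
rewrite horner_coef0 coef_derivn addn0.
by apply: contraNneq => ->; rewrite mul0rn.
Qed.

Lemma Im_le_norm z : 'Im z <= `|z|.
Proof.
apply: le_trans (real_ler_norm (Creal_Im z)) _.
rewrite -(@ler_pXn2r _ 2) ?nnegrE //.
rewrite [X in _ <= X]normC2_Re_Im real_normK ?Creal_Im // lerDr.
by rewrite -real_normK ?Creal_Re // exprn_ge0.
Qed.

Lemma size_normal_factor f (rs : seq C) : f != 0 ->
  f = lead_coef f *: \prod_(r <- rs) ('X - r%:P) -> (size f).-1 = size rs.
Proof.
move=> f0 ->; rewrite size_scale ?lead_coef_eq0 //.
by rewrite (size_prod_XsubC rs id).
Qed.

(** Every root r has |z - r| >= Im (z - r) >= Im z. The bound does not depend on the position of the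
    roots; this uniformity takes the place of Hurwitz's theorem. *)
Lemma lower_rooted_ge_Im f z : lower_rooted f -> 0 <= 'Im z ->
  `|lead_coef f| * ('Im z) ^+ (size f).-1 <= `|f.[z]|.
Proof.
move=> hf hz; have [rs ef hrs] := lower_rooted_factor hf.
have f0 : f != 0 by apply/eqP => f0; move: (hf z hz); rewrite f0 horner0 eqxx.
rewrite (size_normal_factor f0 ef) {2}ef hornerZ normrM ler_wpM2l //.
rewrite horner_prod normr_prod; move: hrs {ef}.
elim: rs => [|r rs ih] /=; first by rewrite big_nil.
move=> /andP[hr hrs]; rewrite exprS big_cons ler_pM ?exprn_ge0 ?ih //.
rewrite hornerXsubC (le_trans _ (Im_le_norm _)) // raddfB /= lerDl oppr_ge0 ltW //.
Qed.

(** Since |z - r| >= -Im r > 0, each factor dominates a multiple of 1 + |z|. The bound is valid up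
    to infinity and replaces compactness when a slice is perturbed. *)
Lemma lower_rooted_coercive f : lower_rooted f ->
  exists2 c : C, 0 < c & forall z, 0 <= 'Im z ->
    c * (1 + `|z|) ^+ (size f).-1 <= `|f.[z]|.
Proof.
move=> hf; have [rs ef hrs] := lower_rooted_factor hf.
have f0 : f != 0 by apply/eqP => f0; move: (hf 0); rewrite f0 horner0 eqxx raddf0 lexx => /(_ isT).
rewrite (size_normal_factor f0 ef).
suff [c c0 hc] : exists2 c : C, 0 < c & forall z, 0 <= 'Im z ->
    c * (1 + `|z|) ^+ size rs <= `|(\prod_(r <- rs) ('X - r%:P)).[z]|.
  exists (`|lead_coef f| * c); first by rewrite mulr_gt0 // normr_gt0 lead_coef_eq0.
  by move=> z hz; rewrite {2}ef hornerZ normrM -mulrA ler_wpM2l // hc.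
elim: rs hrs {ef} => [|r rs ih] /=.
  by exists 1 => // z _; rewrite big_nil hornerC normr1 mulr1.
move=> /andP[hr /ih [c c0 hc]]; set b := - 'Im r.
have b0 : 0 < b by rewrite oppr_gt0.
have h1r : 0 < 1 + `|r| by rewrite ltr_pwDl.
have d0 : 0 < (1 + `|r|) / b + 1 by rewrite ltr_wpDl // ltW // divr_gt0.
exists (((1 + `|r|) / b + 1)^-1 * c) => [|z hz]; first by rewrite mulr_gt0 // invr_gt0.
rewrite big_cons hornerM normrM exprS mulrACA ler_pM ?hc ?mulr_ge0 ?addr_ge0
  ?exprn_ge0 ?addr_ge0 ?invr_ge0 ?(ltW d0) ?(ltW c0) //.
rewrite ler_pdivrMl // hornerXsubC.
have hb : b <= `|z - r|.
  by rewrite (le_trans _ (Im_le_norm _)) // raddfB /= lerDr.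
rewrite mulrDl mul1r (le_trans (y := 1 + `|r| + `|z - r|)) //.
  by rewrite -addrA lerD2l addrC -{1}(subrK r z) ler_normD.
by rewrite lerD2r mulrAC ler_pdivlMr // ler_wpM2l // ltW.
Qed.

Lemma horner_lipschitz f s0 :
  exists2 K : C, 0 <= K & forall s, `|s - s0| <= 1 -> `|f.[s] - f.[s0]| <= K * `|s - s0|.
Proof.
elim/poly_ind: f => [|p c [K K0 hK]].
  by exists 0 => // s _; rewrite !horner0 subrr normr0 mul0r.
exists (K * (1 + `|s0|) + `|p.[s0]|); first by rewrite addr_ge0 // mulr_ge0 // addr_ge0.
move=> s hs; rewrite !hornerMXaddC.
have -> : p.[s] * s + c - (p.[s0] * s0 + c) = (p.[s] - p.[s0]) * s + p.[s0] * (s - s0).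
  by ring.
apply: le_trans (ler_normD _ _) _; rewrite [leRHS]mulrDl !normrM lerD2r.
rewrite mulrAC ler_pM ?hK //.
by rewrite -{1}(subrK s0 s) (le_trans (ler_normD _ _)) // lerD2r.
Qed.

Variables (G : {poly {poly C}}) (m : nat).

(* The outer variable of [G] is that of the slices, the inner one is the parameter. *)
Definition slice s : {poly C} := map_poly (horner_eval s) G.

Hypothesis size_slice : forall s, (size (slice s) <= m.+1)%N.

Lemma slice_lipschitz s0 :
  exists2 K : C, 0 <= K & forall s z, `|s - s0| <= 1 ->
    `|(slice s).[z] - (slice s0).[z]| <= K * `|s - s0| * (1 + `|z|) ^+ m.
Proof.
suff [K K0 hK] : exists2 K : C, 0 <= K & forall s z, `|s - s0| <= 1 ->
    `|\sum_(i < m.+1) (G`_i).[s] * z ^+ i - \sum_(i < m.+1) (G`_i).[s0] * z ^+ i|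
     <= K * `|s - s0| * (1 + `|z|) ^+ m.
  exists K => // s z hs; have hh t : (slice t).[z] = \sum_(i < m.+1) (G`_i).[t] * z ^+ i.
    by rewrite (horner_coef_wide z (size_slice t)); apply: eq_bigr => i _; rewrite coef_map.
  by rewrite !hh hK.
elim: m => [|n [K K0 hK]].
  have [K K0 hK] := horner_lipschitz (G`_0) s0; exists K => // s z hs.
  by rewrite !big_ord1 !expr0 !mulr1 hK.
have [L L0 hL] := horner_lipschitz (G`_n.+1) s0; exists (K + L); first exact: addr_ge0.
move=> s z hs; rewrite big_ord_recr [X in _ - X]big_ord_recr /= [X in `|X|](_ : _ =
   (\sum_(i < n.+1) (G`_i).[s] * z ^+ i - \sum_(i < n.+1) (G`_i).[s0] * z ^+ i)
   + ((G`_n.+1).[s] - (G`_n.+1).[s0]) * z ^+ n.+1); last by rewrite mulrBl opprD addrACA.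
have h1 : 1 <= 1 + `|z| by rewrite lerDl.
apply: le_trans (ler_normD _ _) _; rewrite [(K + L) * _]mulrDl [leRHS]mulrDl lerD //.
  apply: le_trans (hK _ _ hs) _; rewrite ler_wpM2l ?mulr_ge0 //.
  by rewrite exprS ler_peMl // exprn_ge0 // addr_ge0.
rewrite normrM normrX ler_pM ?exprn_ge0 ?hL //.
by rewrite lerXn2r ?nnegrE ?addr_ge0 // lerDr.
Qed.

(** The perturbation is of order (1 + |z|)^m at most; full degree m gives the coercive bound the
    same order, so that it wins for all z at once. *)
Lemma lower_rooted_open s0 : size (slice s0) = m.+1 -> lower_rooted (slice s0) ->
  exists2 d : C, 0 < d & forall s, `|s - s0| < d -> lower_rooted (slice s).
Proof.
move=> sz /lower_rooted_coercive [c c0]; rewrite sz /= => hc.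
have [K K0 hK] := slice_lipschitz s0.
exists (c / (c + K + 1)) => [|s].
  by rewrite divr_gt0 // -addrA addr_gt0 // ltr_wpDl.
have cK : 0 < c + K + 1 by rewrite -addrA addr_gt0 // ltr_wpDl.
rewrite ltr_pdivlMr // => hs z hz; apply/eqP => e.
have hs1 : `|s - s0| <= 1.
  by rewrite -(ler_pM2r cK) mul1r (le_trans (ltW hs)) // -addrA lerDl addr_ge0.
have := hK s z hs1; rewrite e sub0r normrN => h.
have := le_trans (hc z hz) h; rewrite ler_pM2r ?exprn_gt0 ?ltr_pwDl //.
move=> h3; have h4 : K * `|s - s0| <= `|s - s0| * (c + K + 1).
  by rewrite mulrC ler_wpM2l // -addrA addrCA lerDl addr_ge0 // ltW.
by have := lt_le_trans hs (le_trans h3 h4); rewrite ltxx.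
Qed.

(* The lower bound [lower_rooted_ge_Im] passes to the limit. *)
Lemma lower_rooted_closed s0 : (slice s0)`_m != 0 ->
  (forall d : C, 0 < d -> exists2 s, `|s - s0| < d & lower_rooted (slice s)) ->
  forall z, 0 < 'Im z -> (slice s0).[z] != 0.
Proof.
move=> lc0 happ z hz; apply/eqP => e.
have [K K0 hK] := slice_lipschitz s0.
have [L L0 hL] := horner_lipschitz (G`_m) s0.
have hcoef s : (slice s)`_m = (G`_m).[s] by rewrite coef_map.
rewrite hcoef in lc0.
set a := `|(G`_m).[s0]|; set b := 'Im z ^+ m.
have a0 : 0 < a by rewrite normr_gt0.
have b0 : 0 < b by rewrite exprn_gt0.
have a1 := ltW a0; have b1 := ltW b0.
set M := (K * (1 + `|z|) ^+ m + L * b).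
have M0 : 0 <= M by rewrite addr_ge0 // mulr_ge0 // ?(ltW b0) // exprn_ge0 // addr_ge0.
have hM : M = K * (1 + `|z|) ^+ m + L * b by [].
(* In the denominator, a b forces |s - s0| <= 1, b L keeps the top coefficient of the slice at s
   nonzero, and M contradicts the lower bound at z. *)
clearbody M; pose d := a * b / (a * b + M + b * L + b * a).
have E0 : 0 < a * b + M + b * L + b * a.
  by rewrite ltr_wpDl ?mulr_gt0 // !addr_ge0 ?mulr_ge0.
have [|s hs hls] := happ d; first by rewrite divr_gt0 // mulr_gt0.
rewrite ltr_pdivlMr // in hs.
have t0 : 0 <= `|s - s0| by [].
have hs1 : `|s - s0| <= 1.
  by rewrite -(ler_pM2r E0) mul1r (le_trans (ltW hs)) // -!addrA lerDl !addr_ge0 ?mulr_ge0.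
have hLa : `|s - s0| * L < a.
  rewrite -(ltr_pM2r b0); apply: le_lt_trans hs.
  rewrite -mulrA ler_wpM2l // [L * b]mulrC.
  by rewrite addrAC lerDr !addr_ge0 ?mulr_ge0.
have hga : a - `|s - s0| * L <= `|(slice s)`_m|.
  rewrite hcoef lerBlDr -lerBlDl; apply: le_trans (lerB_dist _ _) _.
  by rewrite distrC mulrC hL.
have sz : size (slice s) = m.+1.
  apply/eqP; rewrite eqn_leq size_slice /= ltnNge; apply/negP => hle.
  move: hga; rewrite nth_default // normr0 => h.
  by rewrite subr_le0 in h; have := lt_le_trans hLa h; rewrite ltxx.
have := lower_rooted_ge_Im hls (ltW hz); rewrite lead_coefE sz /= -/b => h1.
have := hK s z hs1; rewrite e subr0 => h2.
have := le_trans (ler_wpM2r (ltW b0) hga) (le_trans h1 h2).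
rewrite mulrBl lerBlDr => h3.
have h4 : K * `|s - s0| * (1 + `|z|) ^+ m + `|s - s0| * L * b
    <= `|s - s0| * (a * b + M + b * L + b * a).
  rewrite [K * _]mulrC -!mulrA -mulrDr ler_wpM2l // -hM.
  by rewrite [a * b + _]addrC -!addrA lerDl !addr_ge0 ?mulr_ge0.
by have := lt_le_trans hs (le_trans h3 h4); rewrite ltxx.
Qed.

End HalfPlane.

(** * The polynomial F_k as a coefficient of a determinant *)

Section Adjugate.
Variables (K : comNzRingType).

(* Up to the sign (-1)^j these are the Newton transformations; they are the coefficients of the
   adjugate of X - r, computed by Horner's scheme, which stops by Cayley-Hamilton. *)
Definition adj_coef n (r : 'M[K]_n) j : 'M[K]_n :=
  \sum_(i < j.+1) (char_poly r)`_(n - j + i) *: r ^+ i.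

Lemma adj_coefS n (r : 'M[K]_n) j : (j < n)%N ->
  adj_coef r j.+1 = ((char_poly r)`_(n - j.+1))%:M + r *m adj_coef r j.
Proof.
move=> hj; rewrite /adj_coef big_ord_recl /= expr0 addn0 scalemx1; congr (_ + _).
rewrite mulmx_sumr; apply: eq_bigr => i _; rewrite exprS -scalemxAr; congr (_ *: _).
by congr (_`_ _); rewrite /bump /= add1n -(subnSK hj) addSnnS.
Qed.

Lemma adj_coef_last n (r : 'M[K]_n) : (0 < n)%N -> adj_coef r n = 0.
Proof.
case: n r => // n' r _; rewrite -(Cayley_Hamilton r) /horner_mx /horner_morph.
rewrite (@horner_coef_wide _ n'.+2); last first.
  by rewrite (leq_trans (size_poly _ _)) // size_char_poly.
by apply: eq_bigr => i _; rewrite subnn add0n coef_map /= -mul_scalar_mx.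
Qed.

Definition adj_char_poly_mx n (r : 'M[K]_n) : 'M[{poly K}]_n :=
  \sum_(j < n) 'X^(n - j.+1) *: map_mx polyC (adj_coef r j).

Lemma mul_adj_char_poly_mx n (r : 'M[K]_n) : (0 < n)%N ->
  char_poly_mx r *m adj_char_poly_mx r = (char_poly r)%:M.
Proof.
(* Horner's recursion turns the j-th term into V j - V j.+1 plus one monomial. The sum telescopes: V
   0 is the top term and V n vanishes by Cayley-Hamilton. *)
move=> n0; pose V j := 'X^(n - j) *: map_mx polyC (adj_coef r j).
have step j : (j < n)%N -> char_poly_mx r *m ('X^(n - j.+1) *: map_mx polyC (adj_coef r j))
    = V j - V j.+1 + (((char_poly r)`_(n - j.+1))%:P * 'X^(n - j.+1))%:M.
  move=> hj; rewrite /V adj_coefS // /char_poly_mx mulmxBl mul_scalar_mx scalerA -exprS subnSK //.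
  rewrite map_mxD map_mxM map_scalar_mx scalerDr scale_scalar_mx -scalemxAr [_%:P * _]mulrC.
  by rewrite opprD addrA [RHS]addrAC subrK.
rewrite /adj_char_poly_mx mulmx_sumr (eq_bigr _ (fun (j : 'I_n) _ => step j (ltn_ord j))).
rewrite big_split /= -(big_mkord xpredT (fun j => V j - V j.+1)).
rewrite (eq_bigr (fun j => - (V j.+1 - V j))); last by move=> j _; rewrite opprB.
rewrite sumrN telescope_sumr // opprB {2}/V adj_coef_last // map_mx0 scaler0 subr0.
rewrite {1}/V /adj_coef big_ord1 expr0 !subn0 addn0 scalemx1 map_scalar_mx scale_scalar_mx.
rewrite -raddf_sum -raddfD /=; congr (_%:M).
rewrite (reindex_inj rev_ord_inj) /=.
rewrite -[RHS]coefK poly_def size_char_poly big_ord_recr /= addrC mulrC mul_polyC.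
by congr (_ + _); apply: eq_bigr => i _; rewrite subnSK // subKn ?(ltnW (ltn_ord i)) // mul_polyC.
Qed.

End Adjugate.

Section PartialPolarization.
Variable (K : comNzRingType).

Definition lower_id_mx n : 'M[K]_(1 + n) := block_mx 0 0 0 1%:M.

Definition pencil_det n (M : 'M[K]_(1 + n)) : {poly K} :=
  \det ('X *: map_mx polyC (lower_id_mx n) - map_mx polyC M).

(* This is the sum of the principal minors of size k + 1 that contain the index 0. *)
Definition polar_sigma n k (M : 'M[K]_(1 + n)) : K :=
  (-1) ^+ k.+1 * (pencil_det M)`_(n - k).

(* Column operations with the adjugate triangularize the pencil after multiplication by the
   characteristic polynomial, which is monic and hence can be cancelled. *)
Lemma pencil_det_block n (a : K) (x : 'rV_n) (y : 'cV_n) (r : 'M_n) : (0 < n)%N ->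
  pencil_det (block_mx a%:M x y r) = - (a%:P * char_poly r)
   - (map_mx polyC x *m adj_char_poly_mx r *m map_mx polyC y) 0 0.
Proof.
move=> n0; rewrite /pencil_det; set M := _ *: _ - _.
set X := map_mx polyC x; set Y := map_mx polyC y; set Q := adj_char_poly_mx r.
have eM : M = block_mx (- a%:P)%:M (- X) (- Y) (char_poly_mx r).
  rewrite /M /lower_id_mx !map_block_mx scale_block_mx opp_block_mx add_block_mx.
  by rewrite !map_mx0 !scaler0 !add0r map_scalar_mx -raddfN map_scalar_mx /= scale_scalar_mx mulr1.
apply: (monic_rreg (char_poly_monic r)) => /=.
have := det_mulmx M (block_mx (char_poly r)%:M 0 (Q *m Y) 1%:M).
rewrite det_lblock det_scalar1 det1 mulr1 => <-.
rewrite eM mulmx_block mulmx1 mulmx0 add0r !mulmxA /Q mul_adj_char_poly_mx // -/Q.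
rewrite !mulmx1 !mul_scalar_mx !mul_mx_scalar scalerN addNr det_ublock; congr (_ * _).
rewrite det_mx11 !mxE eqxx mulr1n; congr (_ + _); first by rewrite mulNr.
  by rewrite mulNmx -sumrN; apply: eq_bigr => j _; rewrite mxE mulNr.
by rewrite mulmx0 add0r.
Qed.

Lemma coef_adj_char_poly_mx n k (x : 'rV[K]_n) (y : 'cV_n) (r : 'M_n) : (k <= n)%N ->
  ((map_mx polyC x *m adj_char_poly_mx r *m map_mx polyC y) 0 0)`_(n - k)
    = if k is j.+1 then (x *m adj_coef r j *m y) 0 0 else 0.
Proof.
move=> hk; rewrite /adj_char_poly_mx mulmx_sumr mulmx_suml summxE coef_sum.
under eq_bigr => j _ do
  rewrite -scalemxAr -scalemxAl -!map_mxM mxE [X in 'X^_ * X]mxE coefMC coefXn.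
case: k hk => [|j] hj.
  apply: big1 => i _; rewrite subn0 (_ : (n == _)%N = false) ?mul0r //.
  by apply/negbTE; rewrite neq_ltn orbC ltn_subrL (leq_ltn_trans _ (ltn_ord i)).
rewrite (bigD1 (Ordinal hj)) //= eqxx mul1r big1 ?addr0 // => i hi.
rewrite (_ : (_ == _)%N = false) ?mul0r //; apply/negbTE; apply: contra hi => /eqP e.
apply/eqP/val_inj => /=; apply: succn_inj.
by rewrite -(subKn (ltn_ord i)) -e subKn.
Qed.

Lemma polar_sigma_block n k (a : K) (x : 'rV_n) (y : 'cV_n) (r : 'M_n) :
    (0 < n)%N -> (k <= n)%N ->
  polar_sigma k (block_mx a%:M x y r) = (-1) ^+ k * (a * (char_poly r)`_(n - k)
    + if k is j.+1 then (x *m adj_coef r j *m y) 0 0 else 0).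
Proof.
move=> n0 hk; rewrite /polar_sigma pencil_det_block // coefB coefN coefCM.
by rewrite coef_adj_char_poly_mx // -opprD exprS mulN1r mulrNN.
Qed.

(** The singular direction lowers the degree of the pencil to n; the case k = 0 of the block formula
    gives the coefficient that remains on top. *)
Lemma pencil_det_lead n (M : 'M[K]_(1 + n)) : (0 < n)%N -> (pencil_det M)`_n = - M 0 0.
Proof.
move=> n0; have := @polar_sigma_block n 0 (M 0 0) (ursubmx M) (dlsubmx M) (drsubmx M) n0 isT.
have -> : (M 0 0)%:M = ulsubmx M.
  by rewrite [RHS]mx11_scalar; congr (_%:M); rewrite !mxE; congr (M _ _); apply/val_inj.
rewrite submxK /polar_sigma expr1 expr0 mulN1r mul1r addr0 subn0 => /eqP.
rewrite eqr_oppLR => /eqP ->.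
have /monicP := char_poly_monic (drsubmx M).
by rewrite lead_coefE size_char_poly /= => ->; rewrite mulr1.
Qed.

End PartialPolarization.

Lemma map_polar_sigma (K L : comNzRingType) (f : {rmorphism K -> L}) n k (M : 'M[K]_(1 + n)) :
  polar_sigma k (map_mx f M) = f (polar_sigma k M).
Proof.
rewrite /polar_sigma rmorphM rmorphXn rmorphN1 -coef_map /pencil_det -det_map_mx.
congr (_ * nth 0 (polyseq (\det _)) _); apply/matrixP => i j.
rewrite !mxE rmorphB rmorphM /= map_polyX !map_polyC.
congr (_ * _ - _); congr (_%:P).
by case: split => a; rewrite !mxE; case: split => b; rewrite !mxE;
  first [exact/esym/rmorph0 | exact/esym/rmorph_nat].
Qed.

Lemma comp_polyZX (K : comNzRingType) (p : {poly K}) (c : K) i :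
  (p \Po (c *: 'X))`_i = c ^+ i * p`_i.
Proof.
elim/poly_ind: p i => [|p d ih] i; first by rewrite comp_poly0 !coef0 mulr0.
rewrite comp_polyD comp_polyM comp_polyX comp_polyC -scalerAr !coefD coefZ !coefMX !coefC.
case: i => [|i] /=; first by rewrite mulr0 expr0 mul1r.
by rewrite ih !addr0 exprS mulrA.
Qed.

(** Scaling the variable along with M takes a factor c^(n+1) out of the determinant, and the
    coefficient of degree n - k gives back c^(n-k). *)
Lemma polar_sigmaZ (F : fieldType) n k (c : F) (M : 'M[F]_(1 + n)) : (k <= n)%N -> c != 0 ->
  polar_sigma k (c *: M) = c ^+ k.+1 * polar_sigma k M.
Proof.
move=> hk c0; rewrite /polar_sigma mulrCA; congr (_ * _).
have e : pencil_det (c *: M) \Po (c *: 'X) = c%:P ^+ n.+1 * pencil_det M.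
  rewrite /pencil_det -det_map_mx -detZ; congr (\det _); apply/matrixP => i j; rewrite !mxE.
  rewrite /= comp_polyB comp_polyM comp_polyX !comp_polyC polyCM mulrBr; congr (_ - _).
  by rewrite -mul_polyC mulrA.
have := congr1 (fun p : {poly F} => p`_(n - k)) e.
rewrite /= comp_polyZX -rmorphXn coefCM => /(canRL (mulKf (expf_neq0 _ c0))) ->.
rewrite mulrA; congr (_ * _); apply: (mulfI (expf_neq0 (n - k) c0)).
by rewrite mulrA divff ?expf_neq0 // mul1r -exprD addnS subnK.
Qed.

Lemma poly_eq_away0 (F : numFieldType) (p q : {poly F}) :
  (forall w, w != 0 -> p.[w] = q.[w]) -> p = q.
Proof.
move=> h; apply/eqP; rewrite -subr_eq0; apply/negPn/negP => h0.
pose rs := [seq i.+1%:R : F | i <- iota 0 (size (p - q))].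
have := @max_poly_roots _ _ rs h0; rewrite size_map size_iota ltnn => H.
suff : false by []; apply: H.
  by apply/allP => _ /mapP[i _ ->]; rewrite rootE hornerD hornerN h ?subrr // pnatr_eq0.
by rewrite map_inj_uniq ?iota_uniq // => i j /eqP; rewrite eqr_nat => /eqP [].
Qed.

(* Gives the degree and the leading coefficient of z |-> F_k(Y + z B) by homogeneity. *)
Lemma coef_reciprocal (F : numFieldType) (g h : {poly F}) m i :
    (forall w, w != 0 -> h.[w] = w ^+ m * g.[w^-1]) ->
  g`_i = if (i <= m)%N then h`_(m - i) else 0.
Proof.
move=> hgh; pose N := maxn (size g) i.+1.
have e : (\sum_(j < N) (g`_j)%:P * 'X^(N - j)) * 'X^m = h * 'X^N.
  apply: poly_eq_away0 => w w0; rewrite !hornerM !hornerXn horner_sum hgh //.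
  rewrite -mulrA mulrC; congr (_ * _); rewrite (@horner_coef_wide _ N) ?leq_maxl //.
  rewrite mulr_suml; apply: eq_bigr => j _.
  rewrite hornerCM hornerXn -mulrA; congr (_ * _).
  by rewrite exprVn [RHS]mulrC expfB_cond // (negbTE w0) add0n ltnW.
have iN : (i < N)%N by rewrite leq_maxr.
have /polyP/(_ (N - i + m)%N) := e.
rewrite !coefMXn ltnNge leq_addl /= addnK coef_sum (bigD1 (Ordinal iN)) //.
rewrite coefCM coefXn eqxx mulr1 big1 => [|j hj]; last first.
  rewrite coefCM coefXn (_ : (_ == _)%N = false) ?mulr0 //.
  apply/negbTE; apply: contra hj => /eqP h0.
  by apply/eqP/val_inj => /=; have := ltn_ord j; lia.
rewrite /= addr0 => ->.
case: (leqP i m) => hi; case: ltnP => h1 //; try by lia.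
by congr (h`_ _); lia.
Qed.

Section Degree.
Variables (F : numFieldType) (n k : nat).
Implicit Types Y B : 'M[F]_(1 + n).

Definition polar_sigma_line Y B : {poly F} :=
  polar_sigma k (map_mx polyC Y + 'X *: map_mx polyC B).

Lemma horner_polar_sigma_line Y B z :
  (polar_sigma_line Y B).[z] = polar_sigma k (Y + z *: B).
Proof.
rewrite -[LHS]/(horner_eval z _) /polar_sigma_line -map_polar_sigma; congr polar_sigma.
by apply/matrixP => i j; rewrite !mxE /= /horner_eval !hornerE mulrC.
Qed.

(** By homogeneity F_k(B + w Y) = w^(k+1) F_k(Y + w^-1 B): exchanging the two matrices reverses the
    coefficients. *)
Lemma coef_polar_sigma_line Y B i : (k <= n)%N ->
  (polar_sigma_line Y B)`_i = if (i <= k.+1)%N then (polar_sigma_line B Y)`_(k.+1 - i) else 0.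
Proof.
move=> hk; apply: coef_reciprocal => w w0.
apply: etrans (horner_polar_sigma_line B Y w) _.
apply: etrans _ (congr1 (GRing.mul (w ^+ k.+1)) (esym (horner_polar_sigma_line Y B w^-1))).
have <- := polar_sigmaZ (Y + w^-1 *: B) hk w0.
by rewrite scalerDr scalerA divff // scale1r addrC.
Qed.

Lemma size_polar_sigma_line Y B : (k <= n)%N -> (size (polar_sigma_line Y B) <= k.+2)%N.
Proof.
move=> hk; apply/leq_sizeP => i hi; rewrite coef_polar_sigma_line //.
by rewrite leqNgt hi.
Qed.

Lemma lead_polar_sigma_line Y B : (k <= n)%N -> (polar_sigma_line Y B)`_k.+1 = polar_sigma k B.
Proof.
move=> hk; rewrite coef_polar_sigma_line // leqnn subnn -horner_coef0.
by rewrite horner_polar_sigma_line scale0r addr0.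
Qed.

End Degree.

(** * Roots of the pencil in the lower half-plane *)

Lemma lower_id_mxE (K : comNzRingType) n (i j : 'I_(1 + n)) :
  lower_id_mx K n i j = ((i == j) && (i != 0))%:R.
Proof.
rewrite /lower_id_mx !mxE.
case: splitP => [i1 hi|i1 hi]; rewrite !mxE; case: splitP => [j1 hj|j1 hj]; rewrite !mxE.
- by rewrite (_ : i != 0 = false) ?andbF //; apply/negbTE/negPn/eqP/val_inj; rewrite /= hi ord1.
- by rewrite (_ : i != 0 = false) ?andbF //; apply/negbTE/negPn/eqP/val_inj; rewrite /= hi ord1.
- by rewrite (_ : i == j = false) //; apply/negbTE/eqP => e; move: hj; rewrite -e hi ord1.
- rewrite -!val_eqE /= hi hj eqn_add2l; congr (_%:R); by rewrite add1n andbT.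
Qed.

Section BaseDirection.
Variables (C : numClosedFieldType) (n : nat) (v : 'rV[C]_(1 + n)).

Definition herm_form (Y : 'M[C]_(1 + n)) : C := \sum_i \sum_j v 0 i * Y i j * (v 0 j)^*.

Lemma herm_form_comb (T z : C) (P X : 'M[C]_(1 + n)) :
  herm_form (T *: P - (X + z%:M)) = T * herm_form P - herm_form X - z * \sum_i `|v 0 i| ^+ 2.
Proof.
rewrite /herm_form !mulr_sumr -!sumrB; apply: eq_bigr => i _.
rewrite !mulr_sumr -!sumrB (bigD1 i) //= [in RHS](bigD1 i) //= !mxE eqxx mulr1n normCK.
rewrite [X in _ + X](eq_bigr (fun j =>
    T * (v 0 i * P i j * (v 0 j)^*) - v 0 i * X i j * (v 0 j)^*)).
  by ring.
by move=> j hj; rewrite !mxE eq_sym (negbTE hj) mulr0n; ring.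
Qed.

Lemma herm_form_real (X : 'M[C]_(1 + n)) :
  (forall i j, (X i j)^* = X j i) -> herm_form X \is Num.real.
Proof.
move=> hX; apply/CrealP; rewrite /herm_form rmorph_sum exchange_big; apply: eq_bigr => i _.
rewrite rmorph_sum; apply: eq_bigr => j _.
by rewrite !rmorphM /= conjCK hX; ring.
Qed.

Lemma herm_form_lower_id_ge0 : 0 <= herm_form (lower_id_mx C n).
Proof.
apply: sumr_ge0 => i _; apply: sumr_ge0 => j _; rewrite lower_id_mxE.
have [<-|] := eqVneq i j; last by rewrite mulr0 mul0r.
rewrite mulrAC -normCK; apply: mulr_ge0 => //; exact: exprn_ge0.
Qed.

End BaseDirection.

(** A null vector v of T P - X - z gives T vPv^* = vXv^* + z |v|^2. The form of X is real, so Im T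
    times vPv^* equals Im z |v|^2 < 0, impossible for Im T >= 0 as P is semidefinite. *)
Lemma pencil_det_lower_rooted (C : numClosedFieldType) n (X : 'M[C]_(1 + n)) (z : C) :
  (forall i j, (X i j)^* = X j i) -> 'Im z < 0 -> lower_rooted (pencil_det (X + z%:M)).
Proof.
move=> hX hz T hT; rewrite /pencil_det -[_.[T]]/(horner_eval T _) -det_map_mx.
set M := map_mx _ _.
have -> : M = T *: lower_id_mx C n - (X + z%:M).
  by apply/matrixP => i j; rewrite !mxE /= /horner_eval !hornerE.
apply/det0P => -[v v0 hv].
pose N := \sum_i `|v 0 i| ^+ 2.
have N0 : 0 < N.
  rewrite lt_neqAle sumr_ge0 ?andbT => [|i _]; last exact: exprn_ge0.
  rewrite eq_sym; apply: contra v0 => /eqP h; apply/eqP/matrixP => a j; rewrite ord1 mxE.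
  have h0 i : xpredT i -> 0 <= `|v 0 i| ^+ 2 by move=> _; exact: exprn_ge0.
  have := psumr_eq0P h0 h; move=> /(_ j isT).
  by move/eqP; rewrite expf_eq0 /= normr_eq0 => /eqP.
have := herm_form_comb v T z (lower_id_mx C n) X.
have -> : herm_form v (T *: lower_id_mx C n - (X + z%:M)) = 0.
  rewrite /herm_form exchange_big big1 // => j _; rewrite -mulr_suml.
  by move/matrixP/(_ 0 j): hv; rewrite !mxE => ->; rewrite mul0r.
move/(congr1 (fun u => 'Im u)); rewrite raddf0 !raddfB /=.
have P0 := herm_form_lower_id_ge0 v; have XR := herm_form_real v hX.
rewrite (Creal_ImP _ XR) subr0 mulrC [z * _]mulrC !ImMl ?ger0_real // ?ltW //.
move/eqP; rewrite eq_sym subr_eq0 => /eqP h.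
have : 0 <= N * 'Im z by rewrite -h mulr_ge0.
by rewrite pmulr_rge0 // lt_geF.
Qed.

(** * Homotopy and propagation of hyperbolicity *)

Section Homotopy.
Local Open Scope complex_scope.
Local Notation re := (@complex.Re R).
Local Notation im := (@complex.Im R).
Local Notation C := (R[i]).
Local Notation toC := (map_mx (real_complex R)).

Lemma normc_real (x : R) : `|x%:C| = `|x|%:C.
Proof. by rewrite normc_def /= expr0n addr0 sqrtr_sqr. Qed.

Lemma normc_realB (x y : R) : `|x%:C - y%:C| = `|x - y|%:C.
Proof. by rewrite -normc_real rmorphB. Qed.

Lemma gt0_complexE (d : R[i]) : 0 < d -> d = (re d)%:C /\ 0 < re d.
Proof. by rewrite ltcE; case: d => a b /= /andP[/eqP -> h]. Qed.

Lemma Im0_complexE (z : R[i]) : 'Im z = 0 -> z = (re z)%:C.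
Proof.
case: z => a b; rewrite -complexIm /= => /(congr1 re) /= h.
by rewrite h.
Qed.

(* The set of parameters below which every slice is lower-rooted is open and closed in [0, 1]:
   a root leaving the lower half-plane would have to be real, or escape to infinity. *)
Lemma homotopy (G : {poly {poly R[i]}}) (m : nat) :
    (forall s, (size (slice G s) <= m.+1)%N) ->
    (forall s : R, 0 <= s <= 1 -> (slice G s%:C)`_m != 0) ->
    (forall s x : R, 0 <= s <= 1 -> (slice G s%:C).[x%:C] != 0) ->
  lower_rooted (slice G 0) -> lower_rooted (slice G 1).
Proof.
move=> hsz hlc hreal h0.
pose L (s : R) := lower_rooted (slice G s%:C).
pose E (s : R) := 0 <= s <= 1 /\ forall t, 0 <= t <= s -> L t.
have E0 : E 0.
  split=> [|t]; first by rewrite lexx ler01.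
  by move=> /le_anti <-.
have [|| sg [sgub sglub]] := completeness E.
- by exists 1 => s [/andP[_ /RleP]].
- by exists 0.
have sg0 : 0 <= sg by apply/RleP; exact: sgub.
have sg1 : sg <= 1 by apply/RleP; apply: sglub => s [/andP[_ /RleP]].
have hlt t : 0 <= t < sg -> L t.
  move=> /andP[t0 tsg].
  have [[s [Es ts]]|hn] := Classical_Prop.classic (exists s, E s /\ t < s).
    by apply: (proj2 Es); rewrite t0 ltW.
  have : sg <= t.
    apply/RleP; apply: sglub => s Es; apply/RleP; rewrite leNgt; apply/negP => hs.
    by apply: hn; exists s.
  by rewrite leNgt tsg.
have hsg01 : 0 <= sg <= 1 by rewrite sg0 sg1.
(* The limit argument only reaches the open half-plane; on the real line [hreal] takes over. *)
have Lsg : L sg.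
  have hup : forall z, 0 < 'Im z -> (slice G sg%:C).[z] != 0.
    apply: (lower_rooted_closed hsz); first exact: hlc.
    move=> d /gt0_complexE [-> d0].
    have [e|ne] := eqVneq sg 0.
      by exists 0; [rewrite e subrr normr0 ltcR | ].
    have sgp : 0 < sg by rewrite lt_neqAle eq_sym ne.
    pose t := Num.max 0 (sg - re d / 2).
    exists t%:C; last first.
      apply: hlt; rewrite le_max lexx /= gt_max sgp /= ltrBlDr ltrDl; lra.
    rewrite normc_realB ltcR ltr_norml; apply/andP; split.
      by rewrite ltrBrDr [_ + sg]addrC lt_max; apply/orP; right; lra.
    by rewrite ltrBlDr gt_max; apply/andP; split; lra.
  move=> z; rewrite le_eqVlt => /orP[/eqP/esym /Im0_complexE ->|]; last exact: hup.
  exact: hreal.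
have [sgE|ne] := eqVneq sg 1; first by move: Lsg; rewrite /L sgE.
have sglt : sg < 1 by rewrite lt_neqAle ne.
have szsg : size (slice G sg%:C) = m.+1.
  apply/eqP; rewrite eqn_leq hsz /= ltnNge; apply/negP => hle.
  by have := hlc sg hsg01; rewrite nth_default // eqxx.
have [d /gt0_complexE [-> d0] hd] := lower_rooted_open hsz szsg Lsg.
pose t := Num.min 1 (sg + re d / 2).
have tE : E t.
  split; first by rewrite ge_min lexx le_min ler01 /=; lra.
  move=> u /andP[u0]; rewrite le_min => /andP[u1 ut].
  have [usg|usg] := ltP u sg; first by apply: hlt; rewrite u0.
  by apply: hd; rewrite normc_realB ltcR ltr_norml; apply/andP; split; lra.
have := sgub _ tE; move/RleP; rewrite /t ge_min => /orP[]; lra.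
Qed.

Lemma polar_sigma_hermitian_neq0 (D : numClosedFieldType) n k (X : 'M[D]_(1 + n)) (z : D) :
    (0 < n)%N -> (k <= n)%N -> (forall i j, (X i j)^*%R = X j i) -> 'Im z < 0 ->
  polar_sigma k (X + z%:M) != 0.
Proof.
move=> n0 hk hX hz; rewrite /polar_sigma mulf_neq0 ?signr_eq0 //.
apply: lower_rooted_coef; first exact: pencil_det_lower_rooted.
(* The pencil has degree n: its coefficient -(X_00 + z) is nonzero because X_00 is real. *)
apply: leq_ltn_trans (leq_subr _ _) _; rewrite ltnNge; apply/negP => hs.
have := pencil_det_lead (X + z%:M) n0; rewrite nth_default // !mxE eqxx mulr1n.
move/eqP; rewrite eq_sym oppr_eq0 addr_eq0 => /eqP h.
have : X 0 0 \is Num.real by apply/CrealP.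
rewrite h realN => /Creal_ImP h0; by rewrite h0 ltxx in hz.
Qed.

Lemma polar_sigmaN_neq0 (F : fieldType) n k (X : 'M[F]_(1 + n)) : (k <= n)%N ->
  polar_sigma k (- X) != 0 -> polar_sigma k X != 0.
Proof.
move=> hk; rewrite -scaleN1r polar_sigmaZ ?oppr_eq0 ?oner_eq0 // mulf_eq0 negb_or => /andP[_].
by [].
Qed.

(** For k <= n, homogeneity applied to -X and -z excludes the lower half-plane too, so all roots z
    are real. *)
Definition hyperbolic n k (A : 'M[R]_(1 + n)) := forall (X : 'M[R]_(1 + n)) (z : C),
  X^T = X -> 0 < im z -> polar_sigma k (toC X + z *: toC A) != 0.

(** Real z are included: the shift i a A keeps zeros off the real line, so [stable] says that z |->
    F_k(X + i a A + z B) is lower-rooted, as the homotopy requires. *)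
Definition stable n k (A B : 'M[R]_(1 + n)) :=
  forall (X : 'M[R]_(1 + n)) (a : R) (z : C), X^T = X -> 0 < a -> 0 <= im z ->
  polar_sigma k (toC X + (0 +i* a) *: toC A + z *: toC B) != 0.

Lemma im_gt0 (z : C) : (0 < 'Im z) = (0 < im z).
Proof. by rewrite -complexIm ltcR. Qed.

Lemma im_ge0 (z : C) : (0 <= 'Im z) = (0 <= im z).
Proof. by rewrite -complexIm ler0c. Qed.

Lemma hyperbolic_id n k : (0 < n)%N -> (k <= n)%N -> hyperbolic k (1%:M : 'M[R]_(1 + n)).
Proof.
move=> n0 hk X z hX hz; apply: polar_sigmaN_neq0 => //.
have -> : - (toC X + z *: toC 1%:M) = toC (- X) + (- z)%:M.
  by rewrite opprD map_mxN map_mx1 -scaleNr scalemx1.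
apply: polar_sigma_hermitian_neq0 => // [i j|].
  by rewrite !mxE -{1}hX mxE; apply/CrealP/complex_realP; eexists.
by rewrite raddfN oppr_lt0 im_gt0.
Qed.

(** Both the base point and the direction of the line may move with the parameter: one homotopy
    varies the direction B, the limit a -> 0 varies the base point. *)
Definition plane n k (Y0 Y1 B0 B1 : 'M[C]_(1 + n)) : {poly {poly C}} :=
  polar_sigma k (map_mx polyC (map_mx polyC Y0 + 'X *: map_mx polyC Y1)
     + 'X *: map_mx polyC (map_mx polyC B0 + 'X *: map_mx polyC B1)).

Lemma slice_plane n k (Y0 Y1 B0 B1 : 'M[C]_(1 + n)) s :
  slice (plane k Y0 Y1 B0 B1) s = polar_sigma_line k (Y0 + s *: Y1) (B0 + s *: B1).
Proof.
rewrite /slice /plane /polar_sigma_line -[LHS]map_polar_sigma; congr polar_sigma.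
apply/matrixP => i j; rewrite !mxE.
by rewrite /= rmorphD rmorphM /= map_polyX !map_polyC /= /horner_eval !hornerE.
Qed.

Section Propagation.
Variables (n k : nat).
Hypothesis hk : (k <= n)%N.
Implicit Types A B X : 'M[R]_(1 + n).

Lemma polar_sigma_toC A : polar_sigma k (toC A) = (polar_sigma k A)%:C.
Proof. exact: map_polar_sigma. Qed.

Lemma toC_comb (s : R) A B : toC (A + s *: B) = toC A + s%:C *: toC B.
Proof. by apply/matrixP => i j; rewrite !mxE rmorphD rmorphM. Qed.

Lemma stable_segment A B0 B1 :
    hyperbolic k A -> stable k A B0 -> B0^T = B0 -> B1^T = B1 ->
    (forall s : R, 0 <= s <= 1 -> polar_sigma k (B0 + s *: (B1 - B0)) != 0) ->
  stable k A B1.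
Proof.
move=> hA hAB0 s0 s1 hseg X a z hX a0 hz.
pose Y := toC X + (0 +i* a) *: toC A.
pose G := plane k Y 0 (toC B0) (toC (B1 - B0)).
have hG (s : R) : slice G s%:C = polar_sigma_line k Y (toC (B0 + s *: (B1 - B0))).
  by rewrite slice_plane scaler0 addr0 -toC_comb.
have hlow : lower_rooted (slice G 1).
  apply: (@homotopy G k.+1).
  - by move=> s; rewrite slice_plane; exact: size_polar_sigma_line.
  - move=> s hs; rewrite hG lead_polar_sigma_line // polar_sigma_toC.
    by have := hseg s hs; apply: contra => /eqP /complexI /eqP.
  - move=> s x hs; rewrite hG horner_polar_sigma_line.
    have : (B0 + s *: (B1 - B0))^T = B0 + s *: (B1 - B0).
      by rewrite linearD linearZ linearB /= s0 s1.
    move: (B0 + _) => D sD.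
    have -> : Y + x%:C *: toC D = toC (X + x *: D) + (0 +i* a) *: toC A.
      by apply: etrans (addrAC _ _ _) (congr1 (+%R^~ _) (esym (toC_comb x X D))).
    by apply: hA => //; rewrite linearD linearZ /= hX sD.
  - move=> w hw; have -> : slice G 0 = polar_sigma_line k Y (toC B0).
      by have := hG 0; rewrite scale0r addr0.
    rewrite horner_polar_sigma_line; apply: hAB0 => //.
    by rewrite -im_ge0.
have := hlow z; rewrite (_ : slice G 1 = polar_sigma_line k Y (toC B1)).
  by rewrite horner_polar_sigma_line im_ge0; apply.
by have := hG 1; rewrite scale1r addrC subrK.
Qed.

(** The limit a -> 0. The degree in z does not drop, its top coefficient being F_k(B) throughout. *)
Lemma stable_hyperbolic A B : stable k A B -> polar_sigma k B != 0 -> hyperbolic k B.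
Proof.
move=> hAB hB X z hX hz.
pose G := plane k (toC X) ('i *: toC A) (toC B) 0.
have hG s : slice G s = polar_sigma_line k (toC X + s *: ('i *: toC A)) (toC B).
  by rewrite slice_plane scaler0 addr0.
have e0 : slice G 0 = polar_sigma_line k (toC X) (toC B) by rewrite hG scale0r addr0.
rewrite -horner_polar_sigma_line -e0; apply: (@lower_rooted_closed _ G k.+1).
- by move=> s; rewrite hG; exact: size_polar_sigma_line.
- rewrite e0 lead_polar_sigma_line // polar_sigma_toC.
  by apply: contra hB => /eqP /complexI /eqP.
- move=> d /gt0_complexE [-> d0]; exists (re d / 2)%:C.
    by rewrite subr0 normc_real ltcR ger0_norm; lra.
  move=> w hw; rewrite hG horner_polar_sigma_line scalerA.
  have -> : (re d / 2)%:C * 'i = 0 +i* (re d / 2) by rewrite -complexiE; simpc.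
  by apply: hAB; rewrite -?im_ge0 //; lra.
- by rewrite im_gt0.
Qed.

Lemma complex_split (u v : R) : u +i* v = u%:C + (0 +i* v).
Proof. by simpc. Qed.

Lemma lmod_regroup (K : pzRingType) (V : lmodType K) (p q r : V) (a u v : K) :
  p + a *: q + (u + v) *: r = p + u *: r + v *: r + a *: q.
Proof. by rewrite addrAC scalerDl addrA. Qed.

Lemma hyperbolic_stable A : A^T = A -> hyperbolic k A -> stable k A A.
Proof.
move=> sA hA X a z hX a0 hz; rewrite -addrA -scalerDl; apply: hA => //.
by case: z hz => u v /= hv; rewrite ltr_wpDr.
Qed.

(** With z = u + i v, the real part u B is absorbed into X, and i a A + i v B is symmetric in the
    two directions; v = 0 is hyperbolicity of A. *)
Lemma stable_swap A B : A^T = A -> B^T = B -> hyperbolic k A -> stable k B A -> stable k A B.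
Proof.
move=> sA sB hA hBA X a [u v] hX a0 /= hv.
have sXB : (X + u *: B)^T = X + u *: B by rewrite linearD linearZ /= hX sB.
have -> : toC X + (0 +i* a) *: toC A + (u +i* v) *: toC B
   = toC (X + u *: B) + (0 +i* v) *: toC B + (0 +i* a) *: toC A.
  rewrite (complex_split u v); apply: etrans (lmod_regroup _ _ _ _ _ _) _.
  exact: (congr1 (fun M => M + _ *: toC B + _ *: toC A) (esym (toC_comb u X B))).
move: hv; rewrite le_eqVlt => /orP[/eqP <-|hv]; last by apply: hBA => //; exact: ltW.
by rewrite scale0r addr0; exact: hA.
Qed.

End Propagation.

End Homotopy.

(** * The cone S *)

Lemma coef_XaddC_exp (K : comNzRingType) (c : K) i m :
  (('X + c%:P) ^+ i)`_m = c ^+ (i - m) *+ 'C(i, m).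
Proof.
elim: i m => [|i ih] m; first by rewrite expr0 coef1 bin0n; case: m.
rewrite exprSr mulrDr coefD coefMX coefMC !ih; case: m => [|m] /=.
  by rewrite !bin0 !mulr1n add0r !subn0 -exprSr.
rewrite binS mulrnDr addrC subSS; congr (_ + _).
have [hm|hm] := ltnP m i; first by rewrite mulrnAl -exprSr -subSn // subSS.
by rewrite bin_small ?mulr0n ?mul0r.
Qed.

Lemma sigmaE n k (r : 'M[R]_n) : (k <= n)%N -> sigma k r = (-1) ^+ k * (char_poly r)`_(n - k).
Proof. by move=> hk; rewrite /sigma hk. Qed.

Lemma sigma0 n (r : 'M[R]_n) : sigma 0 r = 1.
Proof.
rewrite sigmaE // expr0 mul1r subn0; have /monicP := char_poly_monic r.
by rewrite lead_coefE size_char_poly.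
Qed.

(** Taylor expansion of the characteristic polynomial at X - t. The signs cancel, so a shift by t >=
    0 only adds nonnegative terms when r lies in the cone. *)
Lemma sigma_shift n k (r : 'M[R]_n) t : (k <= n)%N ->
  sigma k (r + t%:M) = \sum_(i < k.+1) t ^+ i * sigma (k - i) r *+ 'C(n - k + i, n - k).
Proof.
move=> hk; rewrite sigmaE //.
have -> : char_poly (r + t%:M) = char_poly r \Po ('X + (- t)%:P).
  rewrite /char_poly -det_map_mx; congr (\det _); apply/matrixP => i j; rewrite !mxE /=.
  rewrite comp_polyB comp_polyC raddfMn /= comp_polyX !raddfD !raddfMn /= !raddfN /=.
  by rewrite mulrnBl; ring.
rewrite coef_comp_poly size_char_poly mulr_sumr.
rewrite -(big_mkord xpredT (fun i =>
    (-1) ^+ k * ((char_poly r)`_i * (('X + (- t)%:P) ^+ i)`_(n - k)))).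
rewrite (big_cat_nat _ (n := n - k)) //=; last by rewrite leqW // leq_subr.
rewrite big_nat big1 ?add0r => [|i /andP[_ hi]]; last first.
  by rewrite coef_XaddC_exp bin_small // mulr0n !mulr0.
rewrite -{1}(add0n (n - k)%N) big_addn (_ : (n.+1 - (n - k) = k.+1)%N); last by lia.
rewrite big_mkord; apply: eq_bigr => i _.
have hi := ltn_ord i; rewrite coef_XaddC_exp addnK sigmaE; last by lia.
rewrite (_ : (n - (k - i) = i + (n - k))%N); last by lia.
rewrite !mulrnAr (addnC i); congr (_ *+ _).
have ek : (-1) ^+ k = (-1) ^+ (k - i) * (-1) ^+ i :> R by rewrite -exprD subnK.
rewrite ek -(mulN1r t) exprMn.
have e : (-1) ^+ i * (-1) ^+ i = 1 :> R by rewrite -exprMn mulrNN mulr1 expr1n.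
by rewrite -[RHS]mul1r -[X in _ = X * _]e; ring.
Qed.

Lemma Gamma_gt0 n k j (r : 'M[R]_n) : in_Gamma_plus k r -> (j <= k)%N -> 0 < sigma j r.
Proof.
case: j => [|j] hr hj; first by rewrite sigma0 ltr01.
by apply/RltP; apply: hr.
Qed.

Lemma sigma_shift_gt0 n k (r : 'M[R]_n) t : (k <= n)%N -> in_Gamma_plus k r -> 0 <= t ->
  0 < sigma k (r + t%:M).
Proof.
move=> hk hr ht; rewrite sigma_shift // big_ord_recl /= expr0 subn0 mul1r addn0 binn mulr1n.
rewrite ltr_wpDr ?(Gamma_gt0 hr) // sumr_ge0 // => i _.
by rewrite mulrn_wge0 // mulr_ge0 ?exprn_ge0 // ltW // (Gamma_gt0 hr) // leq_subr.
Qed.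

Lemma sigma_id_gt0 n k : (k <= n)%N -> 0 < sigma k (1%:M : 'M[R]_n).
Proof.
move=> hk; rewrite -[1%:M]add0r sigma_shift // big_ord_recr /= expr1n mul1r subnn sigma0.
rewrite ltr_wpDl ?sumr_ge0 //; last by rewrite pmulrn_lgt0 // bin_gt0 leq_addr.
move=> i _; rewrite mulrn_wge0 // expr1n mul1r sigmaE ?(leq_trans (leq_subr _ _)) //.
rewrite /char_poly /char_poly_mx map_mx0 subr0 det_scalar coefXn.
rewrite (_ : (_ == _)%N = false) ?mulr0 //; apply/negbTE/eqP; have := ltn_ord i; lia.
Qed.

Section Blocks.
Variables (n k : nat).
Hypotheses (hk1 : (0 < k)%N) (hk : (k <= n)%N).

Let n0 : (0 < n)%N. Proof. exact: leq_trans hk. Qed.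

Lemma polar_sigma_diag (c : R) (r : 'M[R]_n) : polar_sigma k (block_mx c%:M 0 0 r) = c * sigma k r.
Proof.
rewrite polar_sigma_block // sigmaE // (_ : (if k is _.+1 then _ else _) = 0).
  by rewrite addr0 mulrCA.
by case: (k) => // j; rewrite mul0mx mul0mx mxE.
Qed.

Lemma polar_sigma_quad (x : 'rV[R]_n) (r : 'M[R]_n) : exists w, forall a s : R,
  polar_sigma k (block_mx a%:M (s *: x) (s *: x)^T r) = a * sigma k r + s ^+ 2 * w.
Proof.
exists ((-1) ^+ k * (x *m adj_coef r k.-1 *m x^T) 0 0) => a s.
rewrite polar_sigma_block // sigmaE // mulrDr mulrCA; congr (_ + _).
case: k hk1 => // j _ /=; rewrite linearZ /= -!scalemxAl -scalemxAr scalerA mxE.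
by rewrite expr2 mulrCA.
Qed.

Lemma block_sym (A : 'M[R]_(1 + n)) : A^T = A ->
  A = block_mx (A 0 0)%:M (ursubmx A) (ursubmx A)^T (drsubmx A).
Proof.
move=> sA; rewrite -{1}[A]submxK; congr block_mx.
  by rewrite [LHS]mx11_scalar; congr (_%:M); rewrite !mxE; congr (A _ _); apply/val_inj.
by apply/matrixP => i j; rewrite !mxE -{1}sA mxE.
Qed.

(** The signs of the sigmas combine with (-1)^i into T_j = (-1)^j [adj_coef] r j; for j = k - 1 this
    accounts for the minus sign in F_k. *)
Lemma Fk_polar_sigma (A : 'M[R]_(1 + n)) : A^T = A -> Fk k A = polar_sigma k A.
Proof.
move=> sA; rewrite (block_sym sA) polar_sigma_block // /Fk.
set A' := block_mx _ _ _ _; have eA : A' = A by rewrite /A' -block_sym.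
have er : blk_r A' = drsubmx A.
  by rewrite eA; apply/matrixP => i j; rewrite !mxE; congr (A _ _); apply/val_inj.
have ex : blk_x A' = ursubmx A.
  by rewrite eA; apply/matrixP => i j; rewrite !mxE ord1; congr (A _ _); apply/val_inj.
rewrite er ex eA sigmaE // mulrDr mulrCA; congr (_ + _).
have -> : newton_T k.-1 (drsubmx A) = (-1) ^+ k.-1 *: adj_coef (drsubmx A) k.-1.
  rewrite /newton_T /adj_coef scaler_sumr; apply: eq_bigr => i _; rewrite scalerA; congr (_ *: _).
  have hi := ltn_ord i; rewrite sigmaE; last by lia.
  rewrite mulrA -exprD subnKC //.
  by congr (_ * nth 0 (polyseq _) _); lia.
rewrite -scalemxAr -scalemxAl mxE; case: k hk1 => // j _ /=.
by rewrite exprS mulN1r mulNr.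
Qed.

Definition in_cone (A : 'M[R]_(1 + n)) :=
  [/\ A^T = A, in_Gamma_plus k (drsubmx A) & 0 < polar_sigma k A].

Lemma in_S_in_cone (A : 'M[R]_(1 + n)) : in_S k A <-> in_cone A.
Proof.
have er : blk_r A = drsubmx A.
  by apply/matrixP => i j; rewrite !mxE; congr (A _ _); apply/val_inj.
split=> [[sA [hr hF]]|[sA hr hF]]; split=> //.
- by rewrite -er.
- by rewrite -Fk_polar_sigma //; apply/RltP.
by rewrite er Fk_polar_sigma //; split=> //; apply/RltP.
Qed.

(** Read off from the homogeneity of F_k at diag(1, r), whose value is sigma_k(r). *)
Lemma sigmaZ (r : 'M[R]_n) s : s != 0 -> sigma k (s *: r) = s ^+ k * sigma k r.
Proof.
move=> s0; apply: (mulfI s0); rewrite -(polar_sigma_diag s (s *: r)) [RHS]mulrA -exprS.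
have -> : block_mx s%:M 0 0 (s *: r) = s *: block_mx 1%:M 0 0 r :> 'M_(1 + n).
  by rewrite scale_block_mx !scaler0 scale_scalar_mx mulr1.
by rewrite polar_sigmaZ // polar_sigma_diag mul1r.
Qed.

End Blocks.

Section Cone.
Variables (n k : nat).
Hypotheses (hk1 : (0 < k)%N) (hk : (k <= n)%N).

Let n0 : (0 < n)%N. Proof. exact: leq_trans hk. Qed.

Lemma sigma_segment_gt0 (r : 'M[R]_n) s : in_Gamma_plus k r -> 0 <= s <= 1 ->
  0 < sigma k ((1 - s)%:M + s *: r).
Proof.
move=> hr /andP[]; rewrite le_eqVlt => /orP[/eqP <-|s0] s1.
  by rewrite subr0 scale0r addr0 sigma_id_gt0.
(* A positive multiple of a nonnegative shift of r. *)
have -> : (1 - s)%:M + s *: r = s *: (r + ((1 - s) / s)%:M).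
  by rewrite scalerDr scale_scalar_mx addrC; congr (_ + _%:M); field; rewrite gt_eqF.
rewrite sigmaZ ?gt_eqF // mulr_gt0 ?exprn_gt0 // sigma_shift_gt0 //.
by rewrite divr_ge0 ?subr_ge0 // ltW.
Qed.

(* B is reached from I through the segment to diag(B_00 + L, r) and the segment from there to B. *)
Lemma stable_in_cone (A B : 'M[R]_(1 + n)) : A^T = A -> hyperbolic k A -> stable k A 1%:M ->
  in_cone k B -> stable k A B.
Proof.
move=> sA hA hAI [sB hr hF].
set r := drsubmx B in hr; pose a := B 0 0; pose x := ursubmx B.
have eB : B = block_mx a%:M x x^T r by exact: block_sym.
(* This L makes a + L positive, for the first segment, and (1 + s) a + L positive for s <= 1, for
   the second. *)
pose L := 2 * `|a| + 1; pose D : 'M[R]_(1 + n) := block_mx (a + L)%:M 0 0 r.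
have aL : - a <= `|a| by rewrite -normrN ler_norm.
have a0 : 0 <= `|a| by [].
have sr : r^T = r by rewrite /r trmx_drsub sB.
have sD : D^T = D by rewrite /D tr_block_mx !trmx0 tr_scalar_mx sr.
have hD : stable k A D.
  apply: (stable_segment hk hA hAI (tr_scalar_mx _ _) sD) => s /andP[s0 s1].
  have -> : 1%:M + s *: (D - 1%:M) =
      block_mx ((1 - s) + s * (a + L))%:M 0 0 ((1 - s)%:M + s *: r) :> 'M_(1 + n).
    rewrite [1%:M]scalar_mx_block /D opp_block_mx add_block_mx scale_block_mx add_block_mx.
    rewrite !subr0 !scaler0 !addr0 -raddfB /= scale_scalar_mx -raddfD /=; congr block_mx.
      by congr (_%:M); ring.
    rewrite scalerBr scale_scalar_mx mulr1 addrCA addrC; congr (_ + _).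
    by rewrite -raddfB.
  rewrite polar_sigma_diag //; apply: lt0r_neq0; rewrite mulr_gt0 //; last first.
    by rewrite sigma_segment_gt0 // s0.
  have : 0 < a + L by rewrite /L; lra.
  by move: (a + L) => b b0; case: (lerP 1 b) => hb; nra.
apply: (stable_segment hk hA hD sD sB) => s /andP[s0 s1].
have [w hw] := polar_sigma_quad hk1 hk x r.
have -> : D + s *: (B - D) = block_mx (a + (1 - s) * L)%:M (s *: x) (s *: x)^T r.
  rewrite eB /D opp_block_mx add_block_mx scale_block_mx add_block_mx.
  rewrite !subr0 subrr scaler0 addr0 !add0r -raddfB /= scale_scalar_mx -raddfD /=.
  by rewrite linearZ; congr block_mx; congr (_%:M); ring.
rewrite hw; have := hw a 1; rewrite !scale1r -eB expr1n mul1r => hB.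
rewrite hB in hF; have sg : 0 < sigma k r by exact: (Gamma_gt0 hr).
(* Eliminating w through F_k(B) leaves s^2 F_k(B) and a term that is nonnegative on the segment. *)
apply: lt0r_neq0; have -> : (a + (1 - s) * L) * sigma k r + s ^+ 2 * w =
  s ^+ 2 * (a * sigma k r + w) + (1 - s) * ((1 + s) * a + L) * sigma k r by ring.
have h1 : 0 < (1 + s) * a + L by rewrite /L; nra.
have [e|ne] := eqVneq s 1; first by rewrite e subrr !mul0r addr0 expr1n mul1r.
rewrite ltr_wpDl ?mulr_ge0 ?exprn_ge0 ?(ltW hF) // !mulr_gt0 //.
by rewrite subr_gt0 lt_neqAle ne.
Qed.

Lemma id_stable (A : 'M[R]_(1 + n)) : in_cone k A -> stable k 1%:M A.
Proof.
have hI : hyperbolic k 1%:M := hyperbolic_id n0 hk.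
have sI : (1%:M)^T = 1%:M :> 'M[R]_(1 + n) by exact: tr_scalar_mx.
exact: (stable_in_cone sI hI (hyperbolic_stable sI hI)).
Qed.

Lemma in_cone_hyperbolic (A : 'M[R]_(1 + n)) : in_cone k A -> hyperbolic k A.
Proof.
by move=> hA; case: (hA) => [_ _ /lt0r_neq0]; exact: (stable_hyperbolic hk (id_stable hA)).
Qed.

Lemma in_cone_stable (A B : 'M[R]_(1 + n)) : in_cone k A -> in_cone k B -> stable k A B.
Proof.
move=> hA; have hhA := in_cone_hyperbolic hA; case: (hA) => sA _ _.
have sI : (1%:M)^T = 1%:M :> 'M[R]_(1 + n) by exact: tr_scalar_mx.
exact: (stable_in_cone sA hhA (stable_swap sA sI hhA (id_stable hA))).
Qed.

End Cone.

(** * Negative real roots on the line through two points of the cone *)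

Section Factorization.
Local Open Scope complex_scope.
Local Notation re := (@complex.Re R).
Local Notation im := (@complex.Im R).
Local Notation C := (R[i]).
Local Notation toC := (map_mx (real_complex R)).
Variables (n k : nat).
Hypotheses (hk1 : (0 < k)%N) (hk : (k <= n)%N).
Implicit Types A B : 'M[R]_(1 + n).

(** Hyperbolicity of B makes z real. If z >= 0, multiplying by i gives a zero of F_k(i A + i z B),
    against stability with X = 0 and a = 1. *)
Lemma polar_sigma_root A B (z : C) : in_cone k A -> in_cone k B ->
  polar_sigma k (toC A + z *: toC B) = 0 -> im z = 0 /\ re z < 0.
Proof.
move=> hA hB h0; have hhB := in_cone_hyperbolic hk1 hk hB.
have [sA _ _] := hA.
have im0 : im z = 0.
  case: (ltgtP (im z) 0) => // hz; exfalso.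
    have sNA : (- A)^T = - A by rewrite linearN /= sA.
    have hNz : 0 < im (- z) by case: z hz {h0} => u v /=; rewrite oppr_gt0.
    have /negP := hhB (- A) (- z) sNA hNz; apply; apply/eqP.
    have -> : toC (- A) + (- z) *: toC B = (-1) *: (toC A + z *: toC B).
      by rewrite map_mxN scaleNr scaleN1r opprD.
    by rewrite polar_sigmaZ ?oppr_eq0 ?oner_eq0 // h0 mulr0.
  by have /negP := hhB A z sA hz; apply; apply/eqP.
split=> //; rewrite ltNge; apply/negP => hre.
have hz : 0 <= im ('i * z) by case: z im0 hre {h0} => u v /= -> hu; rewrite mul0r mul1r add0r.
have s0 : (0 : 'M[R]_(1 + n))^T = 0 by exact: trmx0.
have /negP := in_cone_stable hk1 hk hA hB s0 (@ltr01 R) hz; apply; apply/eqP.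
have -> : toC 0 + (0 +i* 1) *: toC A + ('i * z) *: toC B = 'i *: (toC A + z *: toC B).
  by rewrite map_mx0 add0r scalerDr scalerA.
by rewrite polar_sigmaZ ?h0 ?mulr0 // eq_complex /= oner_eq0 andbF.
Qed.

Lemma polar_sigma_factor A B : in_cone k A -> in_cone k B -> exists2 mu : seq R,
  size mu = k.+1 /\ all (fun m => 0 < m) mu &
  forall t, polar_sigma k (A + t *: B) = polar_sigma k B * \prod_(m <- mu) (m + t).
Proof.
move=> hA hB; have [_ _ hFB] := hB.
pose f := polar_sigma_line k (toC A) (toC B).
have lf : f`_k.+1 = (polar_sigma k B)%:C.
  by apply: etrans (lead_polar_sigma_line _ _ hk) (polar_sigma_toC _ _).
have lf0 : f`_k.+1 != 0 by rewrite lf eq_complex /= negb_and lt0r_neq0.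
have szf : size f = k.+2.
  apply/eqP; rewrite eqn_leq size_polar_sigma_line //= ltnNge; apply/negP => hs.
  by move: lf0; rewrite nth_default // eqxx.
have f0 : f != 0 by rewrite -size_poly_eq0 szf.
have ld : lead_coef f = (polar_sigma k B)%:C by rewrite lead_coefE szf.
have hf z : f.[z] = polar_sigma k (toC A + z *: toC B) := horner_polar_sigma_line _ _ _ _.
have [rs ef] := closed_field_poly_normal f.
have hrs r : r \in rs -> im r = 0 /\ re r < 0.
  move=> hr; apply: (polar_sigma_root hA hB); rewrite -hf ef hornerZ horner_prod.
  by rewrite (big_rem r) //= hornerXsubC subrr mul0r mulr0.
exists [seq - re r | r <- rs].
  split; last by apply/allP => _ /mapP[r /hrs [_ hr] ->]; rewrite oppr_gt0.
  by rewrite size_map -(size_normal_factor f0 ef) szf.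
move=> t; apply: (@complexI R); rewrite -polar_sigma_toC toC_comb -hf ef ld hornerZ [RHS]rmorphM.
congr (_ * _); rewrite horner_prod rmorph_prod big_map; apply: eq_big_seq => r /hrs [h1 _].
by rewrite hornerXsubC; case: r h1 => u v /= ->; rewrite /real_complex_def; simpc; rewrite addrC.
Qed.

(** Homogeneity converts t = l / (1 - l) into a form that still makes sense at l = 1. *)
Lemma polar_sigma_segment A B : in_cone k A -> in_cone k B -> exists2 mu : seq R,
  size mu = k.+1 /\ all (fun m => 0 < m) mu &
  forall l, 0 <= l <= 1 -> polar_sigma k ((1 - l) *: A + l *: B)
     = polar_sigma k B * \prod_(m <- mu) ((1 - l) * m + l).
Proof.
move=> hA hB; have [mu [hs hmu] hF] := polar_sigma_factor hA hB; exists mu => // l /andP[l0].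
rewrite le_eqVlt => /orP[/eqP -> | l1].
  rewrite subrr scale0r add0r scale1r big1 ?mulr1 // => m _; by rewrite mul0r add0r.
have hl : 1 - l != 0 by rewrite subr_eq0 gt_eqF.
have -> : (1 - l) *: A + l *: B = (1 - l) *: (A + (l / (1 - l)) *: B).
  by rewrite scalerDr scalerA; congr (_ + _ *: _); rewrite mulrC divfK.
rewrite polar_sigmaZ // hF mulrCA; congr (_ * _).
rewrite -hs; elim: (mu) => [|m s ih]; first by rewrite !big_nil expr0 mul1r.
rewrite !big_cons /= exprS mulrACA ih; congr (_ * _).
by rewrite mulrDr [(1 - l) * (l / _)]mulrC divfK.
Qed.

End Factorization.

(** * Inequalities between means *)

Section ExpLn.
(* By default these arguments are parsed in [R_scope]. *)
Arguments exp x%_ring_scope.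
Arguments ln x%_ring_scope.

Lemma exp_ge1Dx (x : R) : 1 + x <= exp x.
Proof. by apply/RleP; exact: exp_ineq1_le. Qed.

Lemma expD (x y : R) : exp (x + y) = exp x * exp y.
Proof. exact: exp_plus. Qed.

Lemma lnK (x : R) : 0 < x -> exp (ln x) = x.
Proof. by move=> /RltP; exact: exp_ln. Qed.

Lemma lnM (x y : R) : 0 < x -> 0 < y -> ln (x * y) = ln x + ln y.
Proof. by move=> /RltP hx /RltP hy; exact: ln_mult. Qed.

Lemma exp_gt0 (x : R) : 0 < exp x.
Proof. by apply/RltP; exact: exp_pos. Qed.

Lemma ln_le_sub1 (x : R) : 0 < x -> ln x <= x - 1.
Proof. by move=> hx; have := exp_ge1Dx (ln x); rewrite lnK //; lra. Qed.

Lemma ln_prod (s : seq R) (f : R -> R) : {in s, forall x, 0 < f x} ->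
  0 < \prod_(x <- s) f x /\ ln (\prod_(x <- s) f x) = \sum_(x <- s) ln (f x).
Proof.
elim: s => [_|x s ih hf].
  by rewrite !big_nil; split; [exact: ltr01 | exact: ln_1].
have [|p0 e] := ih; first by move=> y hy; apply: hf; rewrite in_cons hy orbT.
have fx0 : 0 < f x by apply: hf; rewrite mem_head.
by rewrite !big_cons mulr_gt0 // lnM // e.
Qed.

Lemma INRE m : INR m = m%:R.
Proof. by elim: m => [|m ih] //; rewrite S_INR ih -natr1. Qed.

(** Tangent line of exp at the mean a of the logarithms: the deviations from a sum to 0, so only the
    constant terms survive. *)
Lemma exp_mean_ln (s : seq R) (f : R -> R) (m : R) : m = (size s)%:R -> 0 < m ->
  {in s, forall x, 0 < f x} ->
  exp ((\sum_(x <- s) ln (f x)) / m) <= (\sum_(x <- s) f x) / m.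
Proof.
move=> hm m0 hf; set a := (\sum_(x <- s) ln (f x)) / m.
rewrite ler_pdivlMr //.
have step : \sum_(x <- s) exp a * (1 + (ln (f x) - a)) <= \sum_(x <- s) f x.
  rewrite big_seq [leRHS]big_seq; apply: ler_sum => x /hf fx0.
  have e : f x = exp a * exp (ln (f x) - a) by rewrite -expD addrC subrK lnK.
  by rewrite [leRHS]e ler_wpM2l ?exp_ge1Dx // ltW // exp_gt0.
apply: le_trans step; rewrite -mulr_sumr ler_wpM2l ?(ltW (exp_gt0 _)) //.
rewrite big_split /= big_split /= sumrN !big_const_seq !count_predT !iter_addr_0.
rewrite -[a *+ _]mulr_natr -hm /a divfK ?gt_eqF // subrr addr0.
by rewrite hm.
Qed.

Lemma affine_gt0 (mu : seq R) (l : R) : {in mu, forall x, 0 < x} -> 0 <= l <= 1 ->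
  {in mu, forall x, 0 < (1 - l) * x + l}.
Proof.
move=> hmu /andP[l0 l1] x /hmu x0; have [->|ne] := eqVneq l 0; first by lra.
have : 0 < l by rewrite lt_neqAle eq_sym ne.
have : 0 <= (1 - l) * x by rewrite mulr_ge0 ?subr_ge0 // ltW.
by lra.
Qed.

(** Divide by the geometric mean of the d x = (1 - l) x + l and bound the geometric means of x / d x
    and 1 / d x by arithmetic ones; these combine to 1 because (1 - l) x / d x + l / d x = 1. *)
Lemma geometric_mean_concave (mu : seq R) (b l m : R) : m = (size mu)%:R -> 0 < m ->
    0 < b -> {in mu, forall x, 0 < x} -> 0 <= l <= 1 ->
  (1 - l) * exp ((ln (b * \prod_(x <- mu) x)) / m) + l * exp (ln b / m)
   <= exp (ln (b * \prod_(x <- mu) ((1 - l) * x + l)) / m).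
Proof.
move=> hm m0 b0 hmu hl; pose d x := (1 - l) * x + l.
have hd : {in mu, forall x, 0 < d x} := affine_gt0 hmu hl.
case/andP: hl => l0 l1.
have [p1 e1] := ln_prod hmu; have [p2 e2] := ln_prod hd.
rewrite !lnM // e1 e2 ![(ln b + _) / m]mulrDl !expD mulrCA [l * _]mulrC -mulrDr.
rewrite ler_wpM2l ?(ltW (exp_gt0 _)) //.
set E := exp _; set D := exp _.
have D0 : 0 < D := exp_gt0 _.
have hq : {in mu, forall x, 0 < x / d x} by move=> x hx; apply: divr_gt0; [exact: hmu | exact: hd].
have hi : {in mu, forall x, 0 < (d x)^-1} by move=> x hx; rewrite invr_gt0 hd.
have eE : E = D * exp ((\sum_(x <- mu) ln (x / d x)) / m).
  rewrite -expD -mulrDl -big_split /=; congr (exp (_ / _)).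
  apply: eq_big_seq => x hx; rewrite -lnM; [|exact: hd|exact: hq].
  by rewrite mulrC divfK // gt_eqF // hd.
have eD : 1 = D * exp ((\sum_(x <- mu) ln (d x)^-1) / m).
  rewrite -expD -mulrDl -big_split /= big1_seq ?mul0r; first by rewrite -[LHS]exp_0.
  move=> x /= hx; rewrite -lnM; [|exact: hd|exact: hi].
  by rewrite divff ?gt_eqF ?hd //; exact: ln_1.
have h1 := exp_mean_ln hm m0 hq; have h2 := exp_mean_ln hm m0 hi.
have hsum : (1 - l) * ((\sum_(x <- mu) x / d x) / m) + l * ((\sum_(x <- mu) (d x)^-1) / m) = 1.
  rewrite !mulrA -mulrDl !mulr_sumr -big_split /= (eq_big_seq (fun=> 1)).
    by rewrite big_const_seq count_predT iter_addr_0 -hm divff ?gt_eqF.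
  by move=> x hx; rewrite /= mulrA -mulrDl divff // gt_eqF // hd.
have -> : (1 - l) * E + l = D * ((1 - l) * exp ((\sum_(x <- mu) ln (x / d x)) / m)
    + l * exp ((\sum_(x <- mu) ln (d x)^-1) / m)).
  by rewrite mulrDr mulrCA -eE [D * (l * _)]mulrCA -eD mulr1.
rewrite -[leRHS]mulr1 -[X in _ <= _ * X]hsum ler_wpM2l ?(ltW D0) //.
by rewrite lerD // ler_wpM2l // subr_ge0.
Qed.

(** Factor by factor: ln u <= u - 1 at u = x / d and u = 1 / d, whose right-hand sides combine to 0
    with weights 1 - l and l. *)
Lemma log_prod_concave (mu : seq R) (b l : R) :
    0 < b -> {in mu, forall x, 0 < x} -> 0 <= l <= 1 ->
  (1 - l) * ln (b * \prod_(x <- mu) x) + l * ln b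
   <= ln (b * \prod_(x <- mu) ((1 - l) * x + l)).
Proof.
move=> b0 hmu hl; have hd := affine_gt0 hmu hl; case/andP: hl => l0 l1.
have [p1 e1] := ln_prod hmu; have [p2 e2] := ln_prod hd.
rewrite !lnM // e1 e2 mulrDr addrAC -mulrDl subrK mul1r lerD2l mulr_sumr.
rewrite big_seq [leRHS]big_seq; apply: ler_sum => x hx.
have x0 := hmu _ hx; have d0 := hd _ hx; set d := _ + l in d0 *.
have h1 : ln x - ln d <= x / d - 1.
  have q0 : 0 < x / d by rewrite divr_gt0.
  have e : ln x = ln (x / d) + ln d by rewrite -lnM // divfK // gt_eqF.
  by rewrite e addrK ln_le_sub1.
have h2 : - ln d <= d^-1 - 1.
  have q0 : 0 < d^-1 by rewrite invr_gt0.
  have := lnM d0 q0; rewrite divff ?gt_eqF // [ln 1]ln_1 => /esym/eqP.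
  by rewrite addrC addr_eq0 => /eqP <-; exact: ln_le_sub1.
have e : (1 - l) * (x / d - 1) + l * (d^-1 - 1) = 0.
  have h : ((1 - l) * x + l) * d^-1 = 1 by rewrite divff ?gt_eqF.
  have -> : (1 - l) * (x / d - 1) + l * (d^-1 - 1) = ((1 - l) * x + l) * d^-1 - 1.
    by move: d^-1 => i; ring.
  by rewrite h subrr.
have h3 : (1 - l) * (ln x - ln d) + l * (- ln d) <= 0.
  by rewrite -e lerD // ler_wpM2l // subr_ge0.
rewrite -subr_le0; apply: le_trans h3.
by rewrite le_eqVlt; apply/orP; left; apply/eqP; ring.
Qed.

End ExpLn.

(** * Convexity of S and concavity on S *)

Section Concavity.
Variables (n k : nat).
Hypotheses (hk1 : (0 < k)%N) (hk : (k <= n)%N).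
Implicit Types A B : 'M[R]_(1 + n).

Lemma in_S_scale A (t : R) : in_S k A -> 0 < t -> in_S k (t *: A).
Proof.
move=> /(in_S_in_cone hk1 hk) [sA hr hF] t0; apply/(in_S_in_cone hk1 hk); split.
- by rewrite linearZ /= sA.
- move=> j hj1 hj; have -> : drsubmx (t *: A) = t *: drsubmx A
    by apply/matrixP => i i'; rewrite !mxE.
  rewrite sigmaZ ?(leq_trans hj) ?gt_eqF //; apply/RltP; rewrite mulr_gt0 ?exprn_gt0 //.
  exact: (Gamma_gt0 hr).
- by rewrite polar_sigmaZ ?gt_eqF // mulr_gt0 // exprn_gt0.
Qed.

Lemma polar_sigma_add_gt0 A B : in_cone k A -> in_cone k B -> 0 < polar_sigma k (A + B).
Proof.
move=> hA hB; have [mu [_ hmu] hF] := polar_sigma_factor hk1 hk hA hB; have [_ _ hFB] := hB.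
have := hF 1; rewrite scale1r => ->; rewrite mulr_gt0 // big_seq prodr_gt0 // => m hm.
by rewrite addr_gt0 // (allP hmu).
Qed.

End Concavity.

(* Since F_j(diag(1, r)) = sigma_j(r), this follows from the positivity of F_j on sums. *)
Lemma Gamma_add n k (r r' : 'M[R]_n) : (k <= n)%N -> r^T = r -> r'^T = r' ->
  in_Gamma_plus k r -> in_Gamma_plus k r' -> in_Gamma_plus k (r + r').
Proof.
move=> hk sr sr' hr hr' j hj1 hj; have hjn := leq_trans hj hk.
have hcone (q : 'M[R]_n) : q^T = q -> in_Gamma_plus k q ->
    in_cone j (block_mx 1%:M 0 0 q : 'M_(1 + n)).
  move=> sq hq; split.
  - by rewrite tr_block_mx !trmx0 tr_scalar_mx sq.
  - by rewrite block_mxKdr => i hi1 hi; apply: hq => //; exact: leq_trans hj.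
  - by rewrite polar_sigma_diag // mul1r (Gamma_gt0 hq).
have := polar_sigma_add_gt0 hj1 hjn (hcone r sr hr) (hcone r' sr' hr').
rewrite add_block_mx !addr0 -raddfD /= polar_sigma_diag // pmulr_rgt0 ?addr_gt0 ?ltr01 //.
by move/RltP.
Qed.

Lemma in_S_add n k (A B : 'M[R]_(1 + n)) : (0 < k)%N -> (k <= n)%N ->
  in_S k A -> in_S k B -> in_S k (A + B).
Proof.
move=> hk1 hk /(in_S_in_cone hk1 hk) hA /(in_S_in_cone hk1 hk) hB; apply/(in_S_in_cone hk1 hk).
case: (hA) (hB) => [sA rA _] [sB rB _]; split.
- by rewrite linearD /= sA sB.
- have -> : drsubmx (A + B) = drsubmx A + drsubmx B by apply/matrixP => i i'; rewrite !mxE.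
  by apply: Gamma_add => //; rewrite trmx_drsub ?sA ?sB.
- exact: polar_sigma_add_gt0.
Qed.

Lemma Fk_segment n k (A B : 'M[R]_(1 + n)) : (0 < k)%N -> (k <= n)%N ->
  in_S k A -> in_S k B -> exists2 mu : seq R,
  size mu = k.+1 /\ {in mu, forall m, 0 < m} &
  Fk k A = Fk k B * \prod_(m <- mu) m /\
  forall l, 0 <= l <= 1 ->
    Fk k ((1 - l) *: A + l *: B) = Fk k B * \prod_(m <- mu) ((1 - l) * m + l).
Proof.
move=> hk1 hk /(in_S_in_cone hk1 hk) hA /(in_S_in_cone hk1 hk) hB.
case: (hA) (hB) => [sA _ _] [sB _ _].
have [mu [hs /allP hmu] hF] := polar_sigma_segment hk1 hk hA hB.
exists mu => //; rewrite !Fk_polar_sigma //; split=> [|l hl].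
  have := hF 0; rewrite subr0 scale1r scale0r addr0 lexx ler01 => -> //.
  by congr (_ * _); apply: eq_bigr => m _; rewrite mul1r addr0.
by rewrite Fk_polar_sigma ?hF // linearD !linearZ /= sA sB.
Qed.

(* Scalars are Stdlib reals; scalar arithmetic is written with Stdlib's
   Rplus/Rmult/Rminus/Rle/Rlt/Rpower/ln, matrix arithmetic with MathComp. *)
Theorem theorem2p1 (n k : nat) (hk1 : (1 <= k)%N) (hkn : (k <= n)%N) :
  (* S is a convex cone: closed under positive scaling and under addition *)
  (forall (A : 'M[R]_n.+1) (t : R), in_S k A -> Rlt R0 t -> in_S k (t *: A)) /\
  (forall A B : 'M[R]_n.+1, in_S k A -> in_S k B -> in_S k (A + B)) /\
  (* F_k^{1/(k+1)} is concave on S *)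
  (forall (A B : 'M[R]_n.+1) (l : R), in_S k A -> in_S k B ->
     Rle R0 l -> Rle l R1 ->
     Rle (Rplus (Rmult (Rminus R1 l) (Rpower (Fk k A) (Rinv (INR k.+1))))
                (Rmult l (Rpower (Fk k B) (Rinv (INR k.+1)))))
         (Rpower (Fk k ((Rminus R1 l) *: A + l *: B)) (Rinv (INR k.+1)))) /\
  (* log F_k is concave on S *)
  (forall (A B : 'M[R]_n.+1) (l : R), in_S k A -> in_S k B ->
     Rle R0 l -> Rle l R1 ->
     Rle (Rplus (Rmult (Rminus R1 l) (ln (Fk k A))) (Rmult l (ln (Fk k B))))
         (ln (Fk k ((Rminus R1 l) *: A + l *: B)))).
Proof.
split; first by move=> A t hA /RltP; exact: in_S_scale.
split; first by move=> A B; exact: in_S_add.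
split=> A B l hA hB /RleP l0 /RleP l1; apply/RleP;
  have [mu [hs hmu] [-> hF]] := Fk_segment hk1 hkn hA hB;
  rewrite -[Rminus R1 l]/(1 - l) hF ?l0 //;
  have b0 : 0 < Fk k B by case: hB => _ [_ /RltP].
- have m0 : 0 < INR k.+1 by rewrite INRE ltr0n.
  have hl : 0 <= l <= 1 by rewrite l0.
  have hm : INR k.+1 = (size mu)%:R by rewrite INRE hs.
  have := geometric_mean_concave hm m0 b0 hmu hl.
  have hp (y : R) : Rpower y (Rinv (INR k.+1)) = exp (ln y / INR k.+1)%R.
    by rewrite /Rpower Rmult_comm.
  by rewrite !hp.
- by apply: log_prod_concave => //; rewrite l0.
Qed.
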